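(* Let $p,q$ be primes such that $p\equiv 1\mod 4$ and $q\equiv 3\mod 4$, let $d=pq$ and suppose that ${\rm h}(d)=2$. The following conditions are equivalent: (1) $D_d=\{2\}$. (2) $p\equiv 5\mod 8$, $y$ is odd and $d\mid y$. (3) $p\equiv 5\mod 8$, $\left(\frac{p}{q}\right)=-1$ and $d\mid y$.
   Context: Let $d\geq 2$ be a squarefree integer, $K=\mathbb{Q}(\sqrt{d})$, and $\mathcal{O}_K$ its ring of algebraic integers. Set $\omega=\sqrt{d}$ and $\mathsf{d}_K=4d$ if $d\equiv 2,3\mod 4$, and $\omega=\frac{1+\sqrt{d}}{2}$ and $\mathsf{d}_K=d$ if $d\equiv 1\mod 4$; then $\mathcal{O}_K=\mathbb{Z}[\omega]$. Let $\varepsilon>1$ be the fundamental unit of $\mathcal{O}_K$ (i.e., the unit group of $\mathcal{O}_K$ is $\{\pm\varepsilon^k:k\in\mathbb{Z}\}$), and let $x,y$ be the unique nonnegative integers with $\varepsilon=x+y\omega$. For a positive integer $f$ let $\mathcal{O}_f=\mathbb{Z}+f\mathcal{O}_K$ be the order in $K$ with conductor $f$, let ${\rm Pic}(\mathcal{O}_f)$ be its Picard group, and let ${\rm h}(d)=|{\rm Pic}(\mathcal{O}_K)|$ be the class number of $K$. $\left(\frac{a}{b}\right)$ denotes the Kronecker symbol. A prime $p$ is called inert, ramified, split if $\left(\frac{\mathsf{d}_K}{p}\right)=-1,0,1$, respectively. A positive integer $f$ is called an unusual conductor of $d$ if $f$ is squarefree, $f$ is divisible by a ramified prime, $f$ is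 not divisible by a split prime, ${\rm h}(d)=|{\rm Pic}(\mathcal{O}_f)|=2$, and for each ramified prime $p$ with $p\mid f$ and all $a,b\in\mathbb{Z}$ we have $|pa^2-\frac{\mathsf{d}_K}{p}b^2|\neq 4$. $D_d$ denotes the set of unusual conductors of $d$. *)

(* Defs.v *)
From HB Require Import structures.
From mathcomp Require Import all_boot all_order all_algebra all_field finmap.
From mathcomp Require Import boolp classical_sets cardinality.

Set Implicit Arguments.
Unset Strict Implicit.
Unset Printing Implicit Defensive.

Import Order.TTheory GRing.Theory Num.Theory.

Local Open Scope classical_set_scope.
Local Open Scope ring_scope.

(* Subrings of number fields, their ideals, and so on, are subsets of the     *)
(* field algC of complex algebraic numbers.                                   *)

Definition frac_field (O : set algC) : set algC :=
  [set z | exists a b : algC, [/\ O a, O b, b != 0 & z = a / b]].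

Definition fractional_ideal (O I : set algC) : Prop :=
  [/\ I `<=` frac_field O,
      I 0,
      forall a b, I a -> I b -> I (a + b),
      forall r a, O r -> I a -> I (r * a)
    & exists c, [/\ O c, c != 0 & forall a, I a -> O (c * a)]].

Definition ideal_mul (I J : set algC) : set algC :=
  [set z | exists s : seq (algC * algC),
     (forall u, u \in s -> I u.1 /\ J u.2) /\ z = \sum_(u <- s) u.1 * u.2].

Definition invertible_ideal (O I : set algC) : Prop :=
  fractional_ideal O I /\
  exists J, fractional_ideal O J /\ ideal_mul I J = O.

Definition principal_ideals (O : set algC) : set (set algC) :=
  [set P | exists z, [/\ frac_field O z, z != 0 & P = [set z * a | a in O]]].

(* The elements of the Picard group: the cosets of the group of nonzero       *)
(* principal fractional ideals in the group of invertible fractional ideals.  *)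
Definition Pic (O : set algC) : set (set (set algC)) :=
  [set C | exists I, invertible_ideal O I /\
                     C = [set ideal_mul I P | P in principal_ideals O]].

(* This would be 0 if Pic O were infinite, which does not happen for the      *)
(* orders of number fields.                                                   *)
Definition card_Pic (O : set algC) : nat := #|` fset_set (Pic O)|%fset.

Definition squarefree (n : nat) : Prop :=
  forall p : nat, prime p -> ~~ (p ^ 2 %| n)%N.

Definition kronecker_prime (a : int) (p : nat) : int :=
  if (p%:Z %| a)%Z then 0
  else if p == 2%N then
    if ((a %% 8)%Z == 1) || ((a %% 8)%Z == 7) then 1 else -1
  else if [exists x : 'I_p, (p%:Z %| (x : nat)%:Z ^+ 2 - a)%Z] then 1 else -1.

Definition kronecker (a b : int) : int :=
  if b == 0 then (if `|a| == 1 then 1 else 0)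
  else (if (a < 0) && (b < 0) then -1 else 1)
       * \prod_(p <- primes `|b|%N) kronecker_prime a p ^+ logn p `|b|%N.

Definition quad_field (d : nat) : set algC :=
  [set z | exists a b : rat, z = ratr a + ratr b * sqrtC d%:R].

Definition quad_int (d : nat) : set algC :=
  quad_field d `&` [set z | z \in Aint].

Definition omega (d : nat) : algC :=
  if (d %% 4 == 1)%N then (1 + sqrtC d%:R) / 2 else sqrtC d%:R.

Definition disc (d : nat) : nat := if (d %% 4 == 1)%N then d else (4 * d)%N.

Definition quad_order (d f : nat) : set algC :=
  [set z | exists (m : int) (a : algC), quad_int d a /\ z = m%:~R + f%:R * a].

Definition class_number (d : nat) : nat := card_Pic (quad_int d).

Definition ring_units (O : set algC) : set algC :=
  [set u | O u /\ exists v, O v /\ u * v = 1].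

(* In algC, 1 < eps entails that eps is real.                                 *)
Definition fundamental_unit (d : nat) (eps : algC) : Prop :=
  1 < eps /\
  ring_units (quad_int d) = [set u | exists k : int, u = eps ^ k \/ u = - eps ^ k].

Definition ramified_prime (d p : nat) : Prop :=
  prime p /\ kronecker (disc d)%:Z p%:Z = 0.

Definition split_prime (d p : nat) : Prop :=
  prime p /\ kronecker (disc d)%:Z p%:Z = 1.

(* A ramified prime p divides disc d, so the division %/ below is exact.      *)
Definition unusual_conductor (d f : nat) : Prop :=
  [/\ (0 < f)%N /\ squarefree f,
      exists p, ramified_prime d p /\ (p %| f)%N,
      forall p, split_prime d p -> ~~ (p %| f)%N,
      class_number d = card_Pic (quad_order d f) /\
        card_Pic (quad_order d f) = 2%N
    & forall p, ramified_prime d p -> (p %| f)%N -> forall a b : int,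
        `|p%:Z * a ^+ 2 - (disc d %/ p)%N%:Z * b ^+ 2| != 4%:Z].

Definition unusual_conductors (d : nat) : set nat :=
  [set f | unusual_conductor d f].

(* Main.v *)
Require Import Defs.
From mathcomp Require Import all_boot all_order all_algebra all_solvable all_field.
From mathcomp Require Import finmap boolp classical_sets cardinality zify ring.

(* Since q = 3 mod 4, eps has norm 1 and x^2 - 1 = d y^2 factors: if y is     *)
(* even then p a^2 - q b^2 = 1 is solvable, and if y is odd then so is        *)
(* |a^2 - d b^2| = 2 or |p a^2 - q b^2| = 2. These equations say which of the *)
(* ideals above 2, p, q are principal in O_K.                                 *)
(* For a prime l | 2d, the kernel of Pic(O_l) -> Pic(O_K) is                  *)
(* (O_K/l)^* / (Z/l)^* eps^Z, which is trivial iff l does not divide y; for   *)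
(* an odd l not dividing d it is never trivial, because the norm of a power   *)
(* of eps times an integer is a square mod l. In each case the class number   *)
(* is determined by exhibiting explicit ideals of O_f prime to f.             *)
(* If p = 1 mod 8 and |p a^2 - q b^2| = 2 is solvable, then by Legendre's     *)
(* theorem s (p X^2 - q Y^2) = Z^2 has a solution for some sign s, and the    *)
(* ideal (Z, p X + Y sqrt d) has a class of order 4 unless                    *)
(* |p a^2 - q b^2| = 1 is solvable; hence h(d) = 2 forces p = 5 mod 8.        *)

Set Implicit Arguments.
Unset Strict Implicit.
Unset Printing Implicit Defensive.

Import Order.TTheory GRing.Theory Num.Theory.

Local Open Scope classical_set_scope.
Local Open Scope ring_scope.

(** * Quadratic residues *)

(** Since d = 3 mod 4, the maximal order is Z[sqrt d], the ramified primes are 2, p and q, and eps =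
    x + y sqrt d has norm 1. Three solvability statements govern everything: [form_repr1] (p a^2 - q
    b^2 = 1 or -1), [norm_repr2] (norm 2 or -2) and [form_repr2] (p a^2 - q b^2 = 2 or -2); the
    first and third together imply the second. Distributing p and q over the factors of x^2 - 1
    shows that an even y forces [form_repr1] ([y_even_form_repr1]), while an odd y forces
    [norm_repr2] or [form_repr2] ([y_odd_repr2]). If p = 5 mod 8, then 2 and -2 are nonresidues mod
    p, so [norm_repr2] fails.

    Picard groups are compared along Pic(O_f) -> Pic(O_K). Order 2 is proved for a prime conductor
    by showing that this map is injective ([card_Pic_prime]), and refuted by exhibiting three
    inequivalent invertible ideals ([card_Pic_le2]).

    From (1) to (2): the condition at the conductor 2 denies [norm_repr2], and |Pic(O_2)| = 2 then
    makes y odd ([card_Pic2_odd]). So [form_repr2] holds and [form_repr1] fails. Were p or q not a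
    divisor of y, it would itself be an unusual conductor ([card_Pic_ramified]). Finally p = 1 mod 8
    would produce an ideal class of order 4 ([form_repr2_mod8]).

    From (2) to (1): [form_repr1] and [norm_repr2] fail, so 2 is unusual by [card_Pic_two]. An odd
    prime factor of a conductor is impossible, by [card_Pic_ramified_neq2] if it divides d and by
    [card_Pic_unramified_neq2] otherwise.

    Between (2) and (3): an even y gives p a^2 - q b^2 = 1, so p is a square mod q. An odd y gives p
    a^2 - q b^2 = 2 or -2, with the sign fixed by q mod 8; if p were a square mod q, that value
    would be one too, against the supplementary laws. *)

Lemma finField_rootN1 (F : finFieldType) (m : nat) :
  (0 < m)%N -> (2 * m %| #|F|.-1)%N -> exists z : F, z ^+ m = -1.
Proof.
move=> m_gt0 /dvdnP[k Dk].
have F_gt1 := finNzRing_gt1 F.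
have F1_gt0 : (0 < #|F|.-1)%N by case: #|F| F_gt1 => [|[]].
have k_gt0 : (0 < k)%N by move: F1_gt0; rewrite Dk; case: (k).
have unity (z : F) : z != 0 -> z ^+ #|F|.-1 = 1.
  move=> nz; apply: (mulIf nz); rewrite mul1r -exprSr prednK ?expf_card //.
  exact: ltnW.
pose rs := [seq x <- enum F | x != 0].
have rs1 : all #|F|.-1.-unity_root rs.
  by apply/allP=> z; rewrite mem_filter unity_rootE => /andP[/unity-> _].
have szrs : (#|F|.-1 <= size rs)%N.
  rewrite -(cardC1 (0 : F)) cardE /rs /enum_mem -filter_predI.
  by apply: eq_leq; congr size; apply: eq_filter => z; rewrite !inE andbT.
have [g _ prim_g] :=
  hasP (has_prim_root F1_gt0 rs1 (filter_uniq _ (enum_uniq F)) szrs).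
(* As [g] has order [k * (2 * m)], the element [g ^+ (k * m)] is a square root of 1 other than 1. *)
exists (g ^+ k).
have := sqrf_eq1 (g ^+ k ^+ m).
rewrite -!exprM (_ : (k * m * 2 = #|F|.-1)%N); last by rewrite Dk; lia.
rewrite (prim_expr_order prim_g) eqxx => /esym/orP[|/eqP//].
rewrite -(prim_order_dvd prim_g) Dk => /dvdn_leq; nia.
Qed.

Section Residues.

Variables (l : nat) (l_prime : prime l).

Lemma Fp_int (z : 'F_l) : exists a : int, z = a%:~R.
Proof. by exists (Posz (val z)); rewrite -pmulrn natr_Zp. Qed.

Lemma dvdz_Fp (a : int) : (l %| a)%Z = (a%:~R == 0 :> 'F_l).
Proof. exact: dvdz_pcharf (pchar_Fp l_prime) a. Qed.

(* The square roots of c in F are t and - t; as the Frobenius automorphism    *)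
(* exchanges them, they lie outside the prime subfield.                       *)
Lemma nonresidue_Frobenius (F : finFieldType) (t : F) (c a : int) :
    l \in [pchar F] -> odd l -> ~~ (l %| c)%Z ->
  t ^+ 2 = c%:~R -> t ^+ l = - t -> ~~ (l %| a ^+ 2 - c)%Z.
Proof.
move=> lF l_odd; rewrite !(dvdz_pcharf lF) => c_nz t2 tl.
have two_nz : 2%:R != 0 :> F.
  rewrite -(dvdn_pcharf lF) dvdn_prime2 //; apply: contraTneq l_odd => ->.
  by [].
apply: contra c_nz; rewrite rmorphB rmorphXn /= -t2 subr_eq0 eqf_sqr => a_t.
have : t ^+ l = t.
  have := pFrobenius_aut_int lF a; rewrite pFrobenius_autE.
  case/orP: a_t => /eqP->; rewrite ?tl // exprNn tl -signr_odd l_odd expr1.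
  by rewrite mulN1r opprK => /esym.
rewrite tl => /eqP; rewrite eq_sym -subr_eq0 opprK -mulr2n -mulr_natl.
by rewrite mulf_eq0 (negPf two_nz) => /eqP->; rewrite expr0n.
Qed.

Lemma root8_pow (F : fieldType) (z : F) (k r : nat) :
  z ^+ 4 = -1 -> z ^+ (8 * k + r) = z ^+ r.
Proof.
by move=> z4; rewrite exprD exprM (exprM z 4 2) z4 sqrrN !expr1n mul1r.
Qed.

(** As 8 divides l^2 - 1, the field with l^2 elements contains a primitive eighth root of unity. *)
Lemma finField_root8 :
  odd l -> exists2 F : finFieldType, l \in [pchar F] & exists z : F, z ^+ 4 = -1.
Proof.
move=> l_odd; have [F lF cardF] := @pPrimePowerField l 2 l_prime isT.
exists F => //; apply: finField_rootN1 => //.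
have -> : #|F|.-1 = (4 * (l./2 * l./2.+1))%N.
  rewrite cardF -{1}(odd_double_half l) l_odd -muln2 expnS expn1.
  by move: (l./2) => h; lia.
by rewrite (@dvdn_pmul2l 4 2) // dvdn2 oddM /= andbN.
Qed.

(** For an eighth root of unity z, the element z - z^3 = z + 1/z is a square root of 2, and its sign
    changes under z -> z^3 and z -> z^5. For -2 below, z + z^3 plays the same role. *)
Lemma nonresidue2 (a : int) :
  (l %% 8 = 3 \/ l %% 8 = 5)%N -> ~~ (l %| a ^+ 2 - 2)%Z.
Proof.
move=> l_mod8; have l_odd : odd l by lia.
have [F lF [z z4]] := finField_root8 l_odd.
apply: (@nonresidue_Frobenius F (z - z ^+ 3) 2 a lF l_odd).
- by rewrite dvdzE gtnNdvd //=; lia.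
- rewrite -[2%:~R]/(1 + 1); ring: z4.
rewrite -(pFrobenius_autE lF) rmorphB rmorphXn /= pFrobenius_autE -exprM.
rewrite (divn_eq l 8) (mulnC _ 8) mulnDl -mulnA !root8_pow //.
case: l_mod8 => ->; rewrite /=; ring: z4.
Qed.

Lemma nonresidueN2 (a : int) :
  (l %% 8 = 5 \/ l %% 8 = 7)%N -> ~~ (l %| a ^+ 2 + 2)%Z.
Proof.
move=> l_mod8; have l_odd : odd l by lia.
have [F lF [z z4]] := finField_root8 l_odd.
rewrite -(opprK 2).
apply: (@nonresidue_Frobenius F (z + z ^+ 3) (-2) a lF l_odd).
- by rewrite dvdzE gtnNdvd //=; lia.
- rewrite (_ : (-2)%:~R = - (1 + 1)) //; ring: z4.
rewrite -(pFrobenius_autE lF) rmorphD rmorphXn /= pFrobenius_autE -exprM.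
rewrite (divn_eq l 8) (mulnC _ 8) mulnDl -mulnA !root8_pow //.
case: l_mod8 => ->; rewrite /=; ring: z4.
Qed.

(** Here the eighth root of unity z already lies in the prime field, and so do z - z^3 and z^2. *)
Lemma residue2_mod8 : (l %% 8 = 1)%N ->
  exists a b : int, (l %| a ^+ 2 - 2)%Z /\ (l %| b ^+ 2 + 1)%Z.
Proof.
move=> l_mod8; have [||z z4] := @finField_rootN1 'F_l 4 => //.
  by rewrite card_Fp //; apply/dvdnP; exists (l %/ 8)%N; lia.
have [[a Da] [b Db]] := (Fp_int (z - z ^+ 3), Fp_int (z ^+ 2)).
exists a, b; rewrite !dvdz_Fp !(rmorphB, rmorphD, rmorphXn) /= -Da -Db.
split; apply/eqP; last by rewrite -exprM z4 addNr.
rewrite rmorph1; ring: z4.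
Qed.

Lemma Fp_expn_half (z : 'F_l) : odd l -> z != 0 ->
  z ^+ l./2 = 1 \/ z ^+ l./2 = -1.
Proof.
move=> l_odd nz; apply/pred2P; rewrite -sqrf_eq1 -exprM; apply/eqP.
apply: (mulIf nz); rewrite mul1r -exprSr -[RHS]expf_card card_Fp //.
congr (_ ^+ _); lia.
Qed.

(** By Euler's criterion the square of a^((l+1)/4) is a times the Legendre symbol of a. *)
Lemma residue_up_to_sign (a : int) : (l %% 4 = 3)%N -> ~~ (l %| a)%Z ->
  exists v s : int, s ^+ 2 = 1 /\ (l %| v ^+ 2 - s * a)%Z.
Proof.
move=> l_mod4; have l_odd : odd l by lia.
rewrite dvdz_Fp => a_nz.
have v2 : (a ^+ (l %/ 4).+1)%:~R ^+ 2 = a%:~R ^+ l./2 * a%:~R :> 'F_l.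
  by rewrite rmorphXn /= -exprM -exprSr; congr (_ ^+ _); lia.
by case: (Fp_expn_half l_odd a_nz) => half; [pose s := 1 : int | pose s := -1 : int];
  exists (a ^+ (l %/ 4).+1), s; split=> //;
  rewrite dvdz_Fp rmorphB rmorphXn /= rmorphM /= v2 half subrr.
Qed.

Lemma exists_nonresidue : odd l -> exists n : int,
  forall a : int, ~~ (l %| a ^+ 2 - n)%Z.
Proof.
move=> l_odd; have l_gt1 := prime_gt1 l_prime.
have two_nz : 2%:R != 0 :> 'F_l.
  rewrite -(dvdn_pcharf (pchar_Fp l_prime)) dvdn_prime2 //.
  by apply: contraTneq l_odd => ->.
have [||z z_half] := @finField_rootN1 'F_l l./2; first by lia.
  by rewrite card_Fp //; apply/dvdnP; exists 1%N; lia.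
have [n Dn] := Fp_int z; exists n => a.
rewrite dvdz_Fp rmorphB rmorphXn /= -Dn subr_eq0.
apply: contra two_nz => /eqP a2; rewrite -[2%:R]/(1 + 1) addr_eq0 -z_half -a2.
have a_nz : a%:~R != 0 :> 'F_l.
  apply/eqP => a0; move/eqP: z_half; rewrite -a2 a0 expr0n expr0n eq_sym.
  by rewrite (_ : l./2 == 0%N = false) ?oppr_eq0 ?oner_eq0; last by lia.
rewrite -exprM mulnC exprM.
by case: (Fp_expn_half l_odd a_nz) => ->; rewrite ?sqrrN expr1n.
Qed.

(** Otherwise subtracting d would preserve squares mod l; starting from 0, all multiples of d, hence
    all residues, would be squares. The number r^2 - d is the norm of r + sqrt d. *)
Lemma exists_nonresidue_norm (d : int) : odd l -> ~~ (l %| d)%Z ->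
  exists r : int, forall a : int, ~~ (l %| a ^+ 2 - (r ^+ 2 - d))%Z.
Proof.
move=> l_odd d_nz; have [n n_nonres] := exists_nonresidue l_odd.
apply: contrapT => no_r.
have closed (k : nat) : exists a : int, (l %| a ^+ 2 - - (d *+ k))%Z.
  elim: k => [|k [r dv_r]]; first by exists 0; rewrite mulr0n expr0n subrr dvdz0.
  have [a dv_a] : exists a : int, (l %| a ^+ 2 - (r ^+ 2 - d))%Z.
    apply: contrapT => no_a; apply: no_r; exists r => a; apply/negP => dv_a.
    by apply: no_a; exists a.
  exists a; move: (rpredD dv_a dv_r); congr (_ %| _)%Z; rewrite mulrS; ring.
have [k Dk] : exists k : nat, (l %| d *+ k + n)%Z.
  have dF : d%:~R != 0 :> 'F_l by rewrite -dvdz_Fp.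
  have := natr_Zp (- (n%:~R : 'F_l) / d%:~R); set k := val _ => Dk.
  exists k; rewrite dvdz_Fp rmorphD rmorphMn /= -[_ *+ _]mulr_natr.
  by rewrite (Dk : k%:R = _) mulrC divfK // addNr.
have [a dv_a] := closed k; have/negP[] := n_nonres a.
by move: (rpredB dv_a Dk); congr (_ %| _)%Z; ring.
Qed.

End Residues.

(** * The Pell equation *)

Lemma coprime_mul_sqr (u v w : nat) :
  coprime u v -> (u * v = w ^ 2)%N -> exists a : nat, u = (a ^ 2)%N.
Proof.
move=> co_uv uv; exists (gcdn u w); have co : gcdn u v = 1%N by exact/eqP.
rewrite -mulnn muln_gcdr !muln_gcdl mulnn mulnn -uv -mulnn (mulnC w).
by rewrite -!muln_gcdr (gcdnC w) gcdnACA co gcd1n muln1.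
Qed.

Lemma coprime_split_prime (p u v t : nat) : prime p -> coprime u v ->
    (u * v = p * t)%N ->
  (exists2 u1, u = (p * u1)%N & coprime u1 v /\ (u1 * v = t)%N) \/
  (exists2 v1, v = (p * v1)%N & coprime u v1 /\ (u * v1 = t)%N).
Proof.
move=> p_prime co_uv uv; have p_gt0 := prime_gt0 p_prime.
have : (p %| u * v)%N by rewrite uv dvdn_mulr.
rewrite Euclid_dvdM // => /orP[] /dvdnP[k Dk]; move: co_uv uv; rewrite Dk.
  rewrite coprimeMl => /andP[co_k _] /eqP.
  rewrite mulnAC (mulnC _ p) eqn_pmul2l // => /eqP uv.
  by left; exists k; first rewrite mulnC.
rewrite coprimeMr => /andP[co_k _] /eqP.
rewrite mulnA (mulnC _ p) eqn_pmul2l // => /eqP uv.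
by right; exists k; first rewrite mulnC.
Qed.

Lemma coprime_split (p q u v w : nat) : prime p -> prime q -> coprime u v ->
    (u * v = p * q * w ^ 2)%N ->
  exists a b : nat,
    [\/ u = (a ^ 2)%N /\ v = (p * q * b ^ 2)%N,
        u = (p * a ^ 2)%N /\ v = (q * b ^ 2)%N,
        u = (q * a ^ 2)%N /\ v = (p * b ^ 2)%N |
        u = (p * q * a ^ 2)%N /\ v = (b ^ 2)%N].
Proof.
move=> p_prime q_prime co_uv; rewrite -mulnA => uv.
have sqr (u1 v1 : nat) : coprime u1 v1 -> (u1 * v1 = w ^ 2)%N ->
    exists a b, u1 = (a ^ 2)%N /\ v1 = (b ^ 2)%N.
  move=> co uv1; have [a Da] := coprime_mul_sqr co uv1.
  move: uv1; rewrite mulnC coprime_sym in co * => uv1.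
  by have [b Db] := coprime_mul_sqr co uv1; exists a, b.
have [[u1 -> [co1 uv1]] | [v1 -> [co1 uv1]]] :=
  coprime_split_prime p_prime co_uv uv;
have [[u2 D2 [co2 uv2]] | [v2 D2 [co2 uv2]]] :=
  coprime_split_prime q_prime co1 uv1;
have [a [b [Da Db]]] := sqr _ _ co2 uv2; exists a, b; subst => //.
- by constructor 4; rewrite mulnA.
- by constructor 2.
- by constructor 3.
- by constructor 1; rewrite mulnA.
Qed.

(** Presents squares in a form linear in new unknowns, so that [lia] can settle quadratic
    congruences after a split on parity. *)
Lemma sqrz_mod8 (a : int) :
  (exists k j : int, a = 2 * k + 1 /\ a ^+ 2 = 8 * j + 1) \/
  (exists k : int, a = 2 * k /\ a ^+ 2 = 4 * k ^+ 2).
Proof.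
have half (c : int) : exists k : int, c = 2 * k \/ c = 2 * k + 1.
  by exists (c %/ 2)%Z; lia.
have [k [->|->]] := half a; first by right; exists k; split=> //; ring.
have [h [Dk|Dk]] := half k; left.
  by exists k, (h * (k + 1)); split=> //; rewrite Dk; ring.
by exists k, (k * (h + 1)); split=> //; rewrite Dk; ring.
Qed.

Section Pell.

Variables (p q x y : nat).
Hypotheses (p_prime : prime p) (q_prime : prime q).
Hypotheses (p_mod4 : (p %% 4 = 1)%N) (q_mod4 : (q %% 4 = 3)%N).
Hypothesis pell : (x ^ 2 = p * q * y ^ 2 + 1)%N.

(** The form is congruent to -(a^2 + b^2) mod 4, which is never 1; the same holds for the next
    form. *)
Lemma mod4_form (a b : int) : q%:Z * a ^+ 2 - p%:Z * b ^+ 2 != 1.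
Proof.
apply/eqP; rewrite (divn_eq p 4) (divn_eq q 4) p_mod4 q_mod4.
by case: (sqrz_mod8 a) => [[k [h [_ ->]]]|[k [_ ->]]];
  case: (sqrz_mod8 b) => [[l [i [_ ->]]]|[l [_ ->]]]; lia.
Qed.

Lemma mod4_form_pq (a b : int) : (p * q)%N%:Z * a ^+ 2 - b ^+ 2 != 1.
Proof.
apply/eqP; rewrite PoszM (divn_eq p 4) (divn_eq q 4) p_mod4 q_mod4.
by case: (sqrz_mod8 a) => [[k [h [_ ->]]]|[k [_ ->]]];
  case: (sqrz_mod8 b) => [[l [i [_ ->]]]|[l [_ ->]]]; lia.
Qed.

(** With x = 2k + 1 and y = 2y', the consecutive numbers k + 1 and k have product p q y'^2. Of the
    four ways to distribute p and q, congruences mod 4 exclude two; one of the others is a smaller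
    solution of the Pell equation. *)
Lemma pell_even : ~~ odd y ->
  (exists a b : nat, [/\ a ^ 2 = p * q * b ^ 2 + 1,
                      x = a ^ 2 + p * q * b ^ 2 & y = 2 * a * b])%N \/
  (exists a b : int, p%:Z * a ^+ 2 - q%:Z * b ^+ 2 = 1).
Proof.
move=> y_even; pose y' := y./2; have Dy : (y = 2 * y')%N by lia.
have x_odd : odd x.
  by have := congr1 odd pell; rewrite Dy addn1 /= !(oddX, oddM) /= !andbF.
pose k := x./2; have Dx : (x = 2 * k + 1)%N by lia.
have uv : (k.+1 * k = p * q * y' ^ 2)%N.
  by move: pell; rewrite Dx Dy; clear; nia.
have [a [b [[Da Db]|[Da Db]|[Da Db]|[Da Db]]]] :=
  coprime_split p_prime q_prime (coprimeSn k) uv.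
- left; exists a, b; split; [lia | lia |].
  rewrite Dy -mulnA; congr (2 * _)%N; apply/eqP; rewrite -eqn_sqr.
  have pq_gt0 : (0 < p * q)%N by rewrite muln_gt0 !prime_gt0.
  by rewrite -(eqn_pmul2l pq_gt0) -uv Da Db; apply/eqP; ring.
- by right; exists a, b; lia.
- have /eqP[] := mod4_form a b; lia.
- have /eqP[] := mod4_form_pq a b; lia.
Qed.

(** Now x is even, so x + 1 and x - 1 are coprime and differ by 2. *)
Lemma pell_odd : odd y ->
  (exists a b : int, `|a ^+ 2 - (p * q)%N%:Z * b ^+ 2| = 2) \/
  (exists a b : int, `|p%:Z * a ^+ 2 - q%:Z * b ^+ 2| = 2).
Proof.
move=> y_odd.
have x_even : ~~ odd x.
  have := congr1 odd pell; rewrite addn1 /= !(oddX, oddM) y_odd orbT andbT /=.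
  by lia.
have x_gt0 : (0 < x)%N.
  by case: (x) pell => // /eqP; rewrite addn1.
have uv : (x.+1 * x.-1 = p * q * y ^ 2)%N.
  by move: pell; case: (x) x_gt0 => // k _; clear; nia.
have co : coprime x.+1 x.-1.
  rewrite -(prednK x_gt0) /= -addn2 coprime_sym /coprime gcdnDl.
  by rewrite -/(coprime _ _) coprimen2; lia.
have [a [b [[Da Db]|[Da Db]|[Da Db]|[Da Db]]]] :=
  coprime_split p_prime q_prime co uv.
- by left; exists a, b; lia.
- by right; exists a, b; lia.
- by right; exists b, a; lia.
- by left; exists b, a; lia.
Qed.

End Pell.

(** * Legendre's theorem *)

Lemma Euclid_dvdzM (l : nat) (a b : int) : prime l ->
  (l %| a * b)%Z = (l %| a)%Z || (l %| b)%Z.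
Proof. by move=> l_prime; rewrite !dvdzE abszM Euclid_dvdM. Qed.

Lemma Euclid_dvdzX (l : nat) (a : int) (n : nat) : prime l ->
  (l %| a ^+ n.+1)%Z = (l %| a)%Z.
Proof. by move=> l_prime; rewrite !dvdzE abszX Euclid_dvdX // andbT. Qed.

Lemma prime_sqr_ndvd (l : nat) : prime l -> ~~ (l ^ 2 %| l)%N.
Proof.
move=> l_prime; rewrite gtnNdvd ?prime_gt0 //.
by rewrite -[X in (X < _)%N]expn1 ltn_exp2l ?prime_gt1.
Qed.

(** The number A is the integer part of sqrt n plus one: large enough for a pigeonhole count, while
    differences of numbers below A still have square at most n. *)
Lemma sqrt_bound (n : nat) :
  exists A : nat, (n < A ^ 2)%N /\ forall k, (k < A)%N -> (k ^ 2 <= n)%N.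
Proof.
have exA : exists A, (n < A ^ 2)%N by exists n.+1; nia.
exists (ex_minn exA); case: ex_minnP => A ltA minA; split=> // k ltk.
by rewrite leqNgt; apply: contraL ltk; rewrite -leqNgt => /minA.
Qed.

Lemma prime_neq_sqr (n k : nat) : prime n -> (k ^ 2)%N != n.
Proof.
move=> n_prime; apply/eqP => Dn; have n_gt1 := prime_gt1 n_prime.
have /primeP[_ /(_ k)] := n_prime.
rewrite -{1}Dn dvdn_mulr // => /(_ isT)/pred2P[] Dk; move: Dn; rewrite Dk; nia.
Qed.

Lemma sqr_dist_le (i j n : nat) : (i ^ 2 <= n)%N -> (j ^ 2 <= n)%N ->
  (i%:Z - j%:Z) ^+ 2 <= n%:Z.
Proof.
move=> le_i le_j; case/orP: (leq_total i j) => le_ij.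
  have : 0 <= i%:Z * (2 * j%:Z - i%:Z) by apply: mulr_ge0; lia.
  by lia.
have : 0 <= j%:Z * (2 * i%:Z - j%:Z) by apply: mulr_ge0; lia.
by lia.
Qed.

Section Legendre.

Variables (p q : nat) (s c e : int).
Hypotheses (p_prime : prime p) (q_prime : prime q) (neq_pq : p != q).
Hypotheses (s2 : s ^+ 2 = 1).
Hypothesis res_p : (p %| c ^+ 2 + s * q%:Z)%Z.
Hypothesis res_q : (q %| e ^+ 2 - s * p%:Z)%Z.

(** Thue's pigeonhole argument: the box has more than p q points, so two of them agree in both
    congruences, and their difference is the triple. *)
Lemma small_congruent_triple : exists X Y Z : int,
  [/\ [|| X != 0, Y != 0 | Z != 0],
      X ^+ 2 < q%:Z, Y ^+ 2 < p%:Z, Z ^+ 2 <= p%:Z * q%:Z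
    & (p %| Z - c * Y)%Z /\ (q %| Z - e * X)%Z].
Proof.
have [A [ltA leA]] := sqrt_bound q.
have [B [ltB leB]] := sqrt_bound p.
have [C [ltC leC]] := sqrt_bound (p * q).
pose f1 (u : 'I_A * 'I_B * 'I_C) : 'F_p :=
  (Posz u.2)%:~R - c%:~R * (Posz u.1.2)%:~R.
pose f2 (u : 'I_A * 'I_B * 'I_C) : 'F_q :=
  (Posz u.2)%:~R - e%:~R * (Posz u.1.1)%:~R.
pose f u := (f1 u, f2 u).
have /injectivePn[u [v neq_uv Dfuv]] : ~~ injectiveb f.
  apply/negP => /injectiveP/leq_card.
  rewrite !card_prod !card_Fp // !card_ord; apply/negP; rewrite -ltnNge.
  (* Comparing the squares of both counts avoids square roots: A^2 > q, B^2 > p and C^2 > p q. *)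
  rewrite -ltn_sqr !expnMn; apply: leq_trans (_ : (q * p * (p * q)).+1 <= _)%N.
    by rewrite ltnS; nia.
  by apply: ltn_mul => //; apply: ltn_mul.
exists (u.1.1%:Z - v.1.1%:Z), (u.1.2%:Z - v.1.2%:Z), (u.2%:Z - v.2%:Z).
have sq (n D : nat) (i j : 'I_D) : (forall k, (k < D)%N -> (k ^ 2 <= n)%N) ->
    (i%:Z - j%:Z) ^+ 2 <= n%:Z.
  by move=> leD; apply: sqr_dist_le; apply: leD.
have sqlt (n D : nat) (i j : 'I_D) : prime n ->
    (forall k, (k < D)%N -> (k ^ 2 <= n)%N) -> (i%:Z - j%:Z) ^+ 2 < n%:Z.
  move=> n_prime leD; rewrite lt_neqAle sq // andbT.
  apply: contraNneq (prime_neq_sqr `|i%:Z - j%:Z|%N n_prime) => Dn.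
  by rewrite -abszX -eqz_nat gez0_abs ?sqr_ge0 ?Dn.
split; [|exact: sqlt|exact: sqlt|by rewrite -PoszM; apply: sq|].
  apply: contraR neq_uv; rewrite !negb_or !negbK !subr_eq0 => /and3P[].
  case: u v {Dfuv} => [[u1 u2] u3] [[v1 v2] v3] /=.
  by move=> /eqP[/ord_inj->] /eqP[/ord_inj->] /eqP[/ord_inj->].
have Dp : f1 u = f1 v := congr1 fst Dfuv.
have Dq : f2 u = f2 v := congr1 snd Dfuv.
split.
  rewrite (dvdz_Fp p_prime) !(rmorphB, rmorphM) /=; apply/eqP.
  by transitivity (f1 u - f1 v); [rewrite /f1; ring | rewrite Dp subrr].
rewrite (dvdz_Fp q_prime) !(rmorphB, rmorphM) /=; apply/eqP.
by transitivity (f2 u - f2 v); [rewrite /f2; ring | rewrite Dq subrr].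
Qed.

(** The residue conditions make V = s (p X^2 - q Y^2) - Z^2 divisible by p q on the small triple,
    and the size bounds leave only V = 0, which is a solution, or V = - p q, which composition with
    a norm turns into one. *)
Lemma legendre : exists x y z : int,
  [/\ s * (p%:Z * x ^+ 2 - q%:Z * y ^+ 2) = z ^+ 2, z != 0 & coprimez x y].
Proof.
have p_gt1 := prime_gt1 p_prime; have q_gt1 := prime_gt1 q_prime.
suff [x [y [z [Dz nz_z]]]] : exists x y z : int,
    s * (p%:Z * x ^+ 2 - q%:Z * y ^+ 2) = z ^+ 2 /\ z != 0.
  have [g Dg] : exists g, g = gcdz x y by exists (gcdz x y).
  have nz_g : g != 0.
    rewrite Dg gcdz_eq0; apply: contra nz_z => /andP[/eqP x0 /eqP y0].
    by rewrite -sqrf_eq0 -Dz x0 y0; apply/eqP; ring.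
  have [x' Dx] := dvdzP (dvdz_gcdl x y); have [y' Dy] := dvdzP (dvdz_gcdr x y).
  rewrite -Dg in Dx Dy.
  have : (g ^+ 2 %| z ^+ 2)%Z.
    apply/dvdzP; exists (s * (p%:Z * x' ^+ 2 - q%:Z * y' ^+ 2)).
    by rewrite -Dz Dx Dy; ring.
  rewrite dvdz_pexp2r // => /dvdzP[z' Dz'].
  exists x', y', z'; split.
  - apply: (mulIf (_ : g ^+ 2 != 0)); first by rewrite sqrf_eq0.
    by rewrite -exprMn -Dz' -Dz Dx Dy; ring.
  - by apply: contraNneq nz_z => z0; rewrite Dz' z0 mul0r.
  rewrite /coprimez -(inj_eq (mulIf nz_g)) mul1r.
  have g_ge0 : `|g|%:Z = g by rewrite gez0_abs ?Dg.
  by rewrite -{1}g_ge0 mulz_gcdl -Dx -Dy -Dg.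
have [X [Y [Z [nz ltX ltY leZ [/dvdzP[k Dk] /dvdzP[h Dh]]]]]] :=
  small_congruent_triple.
pose V := s * (p%:Z * X ^+ 2 - q%:Z * Y ^+ 2) - Z ^+ 2.
have [m DV] : exists m : int, V = m * (p%:Z * q%:Z).
  apply/dvdzP; rewrite Gauss_dvdz; last first.
    by rewrite /coprimez /= -[gcdz _ _]/(gcdn p q)%:Z; apply/eqP; congr Posz;
      apply/eqP; rewrite -/(coprime p q) prime_coprime // dvdn_prime2.
  apply/andP; split; apply/dvdzP.
    have [t Dt] := dvdzP res_p.
    exists (s * X ^+ 2 - t * Y ^+ 2 - k * (Z + c * Y)).
    have -> : V = s * p%:Z * X ^+ 2 - (c ^+ 2 + s * q%:Z) * Y ^+ 2
      - (Z - c * Y) * (Z + c * Y) by rewrite /V; ring.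
    by rewrite Dt Dk; ring.
  have [t Dt] := dvdzP res_q.
  exists (- s * Y ^+ 2 - t * X ^+ 2 - h * (Z + e * X)).
  have -> : V = - s * q%:Z * Y ^+ 2 - (e ^+ 2 - s * p%:Z) * X ^+ 2
    - (Z - e * X) * (Z + e * X) by rewrite /V; ring.
  by rewrite Dt Dh; ring.
have pq_gt0 : 0 < p%:Z * q%:Z by apply: mulr_gt0; rewrite ltz_nat ltnW.
have [V_lt V_gt] : V < p%:Z * q%:Z /\ - 2 * (p%:Z * q%:Z) < V.
  have pX : p%:Z * X ^+ 2 < p%:Z * q%:Z by rewrite ltr_pM2l // ltz_nat ltnW.
  have qY : q%:Z * Y ^+ 2 < p%:Z * q%:Z.
    by rewrite (mulrC p%:Z) ltr_pM2l // ltz_nat ltnW.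
  have [X0 Y0 Z0] := And3 (sqr_ge0 X) (sqr_ge0 Y) (sqr_ge0 Z).
  have pX0 : 0 <= p%:Z * X ^+ 2 by rewrite mulr_ge0.
  have qY0 : 0 <= q%:Z * Y ^+ 2 by rewrite mulr_ge0.
  rewrite /V; move/eqP: s2; rewrite sqrf_eq1 => /orP[]/eqP->;
    by move: pX qY pX0 qY0 Z0 leZ; clear; lia.
have [m0|m1] : m = 0 \/ m = -1.
  move: V_lt V_gt; rewrite DV ltr_pM2r // gtr_pMl // => m_lt1 m_gt.
  by move: m_lt1 m_gt; clear; lia.
- exists X, Y, Z; split; first by apply/eqP; rewrite -subr_eq0 -/V DV m0 mul0r.
  apply: contraTneq nz => Z0; move: DV; rewrite m0 mul0r /V Z0 expr0n subr0.
  move=> /eqP; rewrite mulf_eq0 -[s == 0]sqrf_eq0 s2 /= subr_eq0 => /eqP DX.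
  have : (q %| p%:Z * X ^+ 2)%Z by rewrite DX dvdz_mulr.
  rewrite Euclid_dvdzM // dvdzE /= dvdn_prime2 // eq_sym (negPf neq_pq) /=.
  rewrite Euclid_dvdzX // => /dvdzP[j DX'].
  have X0 : X = 0.
    apply/eqP; apply: contraTT ltX; rewrite -leNgt DX' mulf_eq0 negb_or.
    case/andP=> nz_j _; have j2_gt0 : 1 <= j ^+ 2 by move: nz_j; clear; nia.
    rewrite exprMn -[leLHS]mul1r; apply: ler_pM => //.
    by move: q_gt1; clear; nia.
  move/eqP: DX; rewrite X0 expr0n mulr0 eq_sym mulf_eq0 sqrf_eq0.
  by case/orP => [/eqP q0|->//]; move: q_gt1 q0; clear; lia.
(* Here Z^2 - p q equals s (p X^2 - q Y^2). Multiplying the form by the norm Z^2 - p q therefore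
   makes its value a square, and the new coordinates come from this composition. *)
exists (X * Z - s * q%:Z * Y), (Y * Z - s * p%:Z * X), (Z ^+ 2 - p%:Z * q%:Z).
split; last first.
  rewrite subr_eq0; apply: contra neq_pq => /eqP Z2.
  have : (p %| Z ^+ 2)%Z by rewrite Z2 dvdz_mulr.
  rewrite Euclid_dvdzX // => /dvdzP[j Dj].
  have Dq : q%:Z = j ^+ 2 * p%:Z.
    have nz_p : p%:Z != 0 by rewrite eqz_nat -lt0n ltnW.
    by apply: (mulfI nz_p); rewrite -Z2 Dj; ring.
  rewrite -dvdn_prime2 //.
  by rewrite -[(p %| q)%N]/(p%:Z %| q%:Z)%Z; apply/dvdzP; exists (j ^+ 2).
have DZ : Z ^+ 2 = s * (p%:Z * X ^+ 2 - q%:Z * Y ^+ 2) + p%:Z * q%:Z.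
  by move: DV; rewrite /V m1 => /eqP; rewrite subr_eq => /eqP->; ring.
transitivity ((Z ^+ 2 - s ^+ 2 * (p%:Z * q%:Z))
              * (s * (p%:Z * X ^+ 2 - q%:Z * Y ^+ 2))); first by ring.
by rewrite s2 mul1r [RHS]expr2; congr (_ * _); rewrite DZ addrK.
Qed.

End Legendre.

(** * Ideals and the Picard group *)

Definition is_subring (O : set algC) : Prop :=
  [/\ O 1, forall a b, O a -> O b -> O (a - b)
         & forall a b, O a -> O b -> O (a * b)].

Definition is_submodule (O I : set algC) : Prop :=
  [/\ I 0, forall a b, I a -> I b -> I (a + b)
         & forall r a, O r -> I a -> I (r * a)].

Definition scale (z : algC) (I : set algC) : set algC := [set z * a | a in I].

Definition ideal_equiv (O I J : set algC) : Prop :=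
  exists z, [/\ frac_field O z, z != 0 & I = scale z J].

(** * Products and multiples of sets of algebraic numbers *)

Section IdealMul.

Implicit Types I J L S : set algC.

Lemma ideal_mul_mem I J a b : I a -> J b -> ideal_mul I J (a * b).
Proof.
move=> Ia Jb; exists [:: (a, b)]; split; last by rewrite big_seq1.
by move=> u; rewrite inE => /eqP->.
Qed.

Lemma ideal_mul0 I J : ideal_mul I J 0.
Proof. by exists [::]; split=> //; rewrite big_nil. Qed.

Lemma ideal_mulD I J a b :
  ideal_mul I J a -> ideal_mul I J b -> ideal_mul I J (a + b).
Proof.
move=> [s [IJs ->]] [t [IJt ->]]; exists (s ++ t); split; last by rewrite big_cat.
by move=> u; rewrite mem_cat => /orP[/IJs | /IJt].
Qed.

Lemma ideal_mul_sub I J S : S 0 -> (forall a b, S a -> S b -> S (a + b)) ->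
  (forall a b, I a -> J b -> S (a * b)) -> ideal_mul I J `<=` S.
Proof.
move=> S0 SD SM _ [s [IJs ->]]; elim: s IJs => [|u s IHs] IJs.
  by rewrite big_nil.
rewrite big_cons; apply: SD.
  by have [Iu Ju] := IJs u (mem_head _ _); apply: SM.
by apply: IHs => v sv; apply: IJs; rewrite inE sv orbT.
Qed.

Lemma ideal_mulC I J : ideal_mul I J = ideal_mul J I.
Proof.
suff sub K L : ideal_mul K L `<=` ideal_mul L K by apply/seteqP; split; apply: sub.
apply: ideal_mul_sub; [exact: ideal_mul0 | exact: ideal_mulD |].
by move=> a b Ka Lb; rewrite mulrC; apply: ideal_mul_mem.
Qed.

Lemma ideal_mulA I J L : ideal_mul I (ideal_mul J L) = ideal_mul (ideal_mul I J) L.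
Proof.
have sub K M N : ideal_mul K (ideal_mul M N) `<=` ideal_mul (ideal_mul K M) N.
  apply: ideal_mul_sub; [exact: ideal_mul0 | exact: ideal_mulD |].
  move=> a c Ka; move: c; apply: ideal_mul_sub.
  - by rewrite mulr0; apply: ideal_mul0.
  - by move=> b c Kb Kc; rewrite mulrDr; apply: ideal_mulD.
  move=> b c Mb Nc; rewrite mulrA.
  by apply: ideal_mul_mem => //; apply: ideal_mul_mem.
apply/seteqP; split; first exact: sub.
have := sub L J I; rewrite (ideal_mulC L) (ideal_mulC J I).
by rewrite (ideal_mulC (ideal_mul L J)) (ideal_mulC L).
Qed.

Lemma ideal_mulACA I J L S : ideal_mul (ideal_mul I J) (ideal_mul L S) =
  ideal_mul (ideal_mul I L) (ideal_mul J S).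
Proof. by rewrite -!ideal_mulA (ideal_mulA J L) (ideal_mulC J) -(ideal_mulA L). Qed.

Lemma scale_mem z I a : I a -> scale z I (z * a).
Proof. by move=> Ia; exists a. Qed.

Lemma scale_scale y z I : scale y (scale z I) = scale (y * z) I.
Proof.
apply/seteqP; split=> [_ [_ [a Ia <-] <-] | _ [a Ia <-]].
  by exists a; rewrite ?mulrA.
by exists (z * a); [apply: scale_mem | rewrite mulrA].
Qed.

Lemma scale1 I : scale 1 I = I.
Proof.
apply/seteqP; split=> [_ [a Ia <-] | a Ia]; first by rewrite mul1r.
by exists a; rewrite ?mul1r.
Qed.

Lemma scaleVK z I : z != 0 -> scale z^-1 (scale z I) = I.
Proof. by move=> nz; rewrite scale_scale mulVf ?scale1. Qed.

Lemma scaleKV z I : z != 0 -> scale z (scale z^-1 I) = I.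
Proof. by move=> nz; rewrite scale_scale mulfV ?scale1. Qed.

Lemma ideal_mul_scale z I J : ideal_mul (scale z I) J = scale z (ideal_mul I J).
Proof.
apply/seteqP; split.
  apply: ideal_mul_sub.
  - by exists 0; [apply: ideal_mul0 | rewrite mulr0].
  - move=> _ _ [a IJa <-] [b IJb <-].
    by exists (a + b); [apply: ideal_mulD | rewrite mulrDr].
  move=> _ b [a Ia <-] Jb.
  by exists (a * b); [apply: ideal_mul_mem | rewrite mulrA].
move=> _ [c IJc <-]; move: c IJc; apply: ideal_mul_sub.
- by rewrite mulr0; apply: ideal_mul0.
- by move=> b c IJb IJc; rewrite mulrDr; apply: ideal_mulD.
by move=> a b Ia Jb; rewrite mulrA; apply: ideal_mul_mem => //; apply: scale_mem.
Qed.

Lemma ideal_mul_closed (r : algC) I J : (forall a, I a -> I (r * a)) ->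
  forall c, ideal_mul I J c -> ideal_mul I J (r * c).
Proof.
move=> rI; apply: ideal_mul_sub.
- by rewrite mulr0; apply: ideal_mul0.
- by move=> b c IJb IJc; rewrite mulrDr; apply: ideal_mulD.
by move=> a b Ia Jb; rewrite mulrA; apply: ideal_mul_mem => //; apply: rI.
Qed.

End IdealMul.

(** * Fractional ideals of a ring and the size of its Picard group *)

Section Ring.

Variable O : set algC.
Hypothesis ringO : is_subring O.
Implicit Types I J L : set algC.

Lemma ring1 : O 1. Proof. by case: ringO. Qed.
Lemma ringB a b : O a -> O b -> O (a - b). Proof. by case: ringO => _ + _; apply. Qed.
Lemma ringM a b : O a -> O b -> O (a * b). Proof. by case: ringO => _ _; apply. Qed.
Lemma ring0 : O 0. Proof. by rewrite -(subrr 1); apply: ringB; apply: ring1. Qed.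
Lemma ringN a : O a -> O (- a).
Proof. by move=> Oa; rewrite -sub0r; apply: ringB; first exact: ring0. Qed.
Lemma ringD a b : O a -> O b -> O (a + b).
Proof. by move=> Oa Ob; rewrite -(opprK b); apply: ringB => //; apply: ringN. Qed.
Lemma ring_int (n : int) : O n%:~R.
Proof.
have nat_O (k : nat) : O k%:R.
  by elim: k => [|k Ok]; [apply: ring0 | rewrite -natr1; apply: ringD; last exact: ring1].
by case: n => k; rewrite ?NegzE ?rmorphN; [|apply: ringN]; apply: nat_O.
Qed.

Lemma is_submodule_self : is_submodule O O.
Proof. by split; [exact: ring0 | exact: ringD | exact: ringM]. Qed.

Lemma frac_field_mem a : O a -> frac_field O a.
Proof. by exists a, 1; rewrite divr1 oner_eq0; split=> //; apply: ring1. Qed.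

Lemma frac_fieldM a b : frac_field O a -> frac_field O b -> frac_field O (a * b).
Proof.
move=> [r [s [Or Os nz_s ->]]] [t [u [Ot Ou nz_u ->]]].
by exists (r * t), (s * u); rewrite mulf_neq0 // mulf_div; split=> //; apply: ringM.
Qed.

Lemma frac_fieldV a : a != 0 -> frac_field O a -> frac_field O a^-1.
Proof.
move=> nz_a [r [s [Or Os nz_s Da]]]; exists s, r; split=> //; last by rewrite Da invf_div.
by apply: contraNneq nz_a => r0; rewrite Da r0 mul0r.
Qed.

Lemma frac_field_denom c a : O c -> c != 0 -> O (c * a) -> frac_field O a.
Proof.
by move=> Oc nz_c Oca; exists (c * a), c; split=> //; rewrite mulrC mulKf.
Qed.

Lemma fractional_ideal_submodule I : fractional_ideal O I -> is_submodule O I.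
Proof. by case. Qed.

Lemma fractional_idealP I c : is_submodule O I -> O c -> c != 0 ->
  (forall a, I a -> O (c * a)) -> fractional_ideal O I.
Proof.
move=> [I0 ID IM] Oc nz_c OcI; split=> //; last by exists c.
by move=> a Ia; apply: (frac_field_denom Oc) => //; apply: OcI.
Qed.

Lemma is_submodule_mul I J : is_submodule O I -> is_submodule O (ideal_mul I J).
Proof.
case=> I0 ID IM; split; [exact: ideal_mul0 | exact: ideal_mulD |].
by move=> r a Or; apply: ideal_mul_closed => b; apply: IM.
Qed.

Lemma is_submodule_scale z I : is_submodule O I -> is_submodule O (scale z I).
Proof.
case=> I0 ID IM; split; first by exists 0; rewrite ?mulr0.
  by move=> _ _ [a Ia <-] [b Ib <-]; exists (a + b); [apply: ID | rewrite mulrDr].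
by move=> r _ Or [a Ia <-]; exists (r * a); [apply: IM | rewrite mulrCA].
Qed.

Lemma fractional_ideal_scale z I :
  frac_field O z -> fractional_ideal O I -> fractional_ideal O (scale z I).
Proof.
move=> [r [s [Or Os nz_s ->]]] fracI; have [_ _ _ _ [c [Oc nz_c OcI]]] := fracI.
apply: (@fractional_idealP _ (s * c)).
- exact/is_submodule_scale/fractional_ideal_submodule.
- exact: ringM.
- by rewrite mulf_neq0.
move=> _ [a Ia <-]; have -> : s * c * (r / s * a) = r * (c * a) by field.
by apply: ringM => //; apply: OcI.
Qed.

Lemma ideal_mul_ring I : is_submodule O I -> ideal_mul I O = I.
Proof.
case=> I0 ID IM; apply/seteqP; split.
  by apply: ideal_mul_sub => // a b Ia Ob; rewrite mulrC; apply: IM.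
by move=> a Ia; rewrite -[a]mulr1; apply: ideal_mul_mem => //; apply: ring1.
Qed.

Lemma ideal_mul_principal I z :
  is_submodule O I -> ideal_mul I (scale z O) = scale z I.
Proof. by move=> modI; rewrite ideal_mulC ideal_mul_scale ideal_mulC ideal_mul_ring. Qed.

Lemma invertible_ideal_ring : invertible_ideal O O.
Proof.
have fracO : fractional_ideal O O.
  apply: (@fractional_idealP _ 1); rewrite ?oner_eq0 //; first exact: is_submodule_self.
    exact: ring1.
  by move=> a; rewrite mul1r.
by split=> //; exists O; split=> //; apply/ideal_mul_ring/is_submodule_self.
Qed.

Lemma ideal_equiv_sym I J : ideal_equiv O I J -> ideal_equiv O J I.
Proof.
move=> [z [Fz nz ->]]; exists z^-1; rewrite invr_eq0 scaleVK //.
by split=> //; apply: frac_fieldV.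
Qed.

Definition ideal_class I : set (set algC) :=
  [set ideal_mul I P | P in principal_ideals O].

Lemma ideal_class_eq I J : is_submodule O I -> is_submodule O J ->
  ideal_class I = ideal_class J <-> ideal_equiv O I J.
Proof.
move=> modI modJ; split=> [eqIJ | ].
  have : ideal_class I I.
    exists (scale 1 O); last by rewrite scale1 ideal_mul_ring.
    by exists 1; rewrite oner_eq0; split=> //; apply/frac_field_mem/ring1.
  rewrite eqIJ => -[_ [z [Fz nz ->]] <-].
  by exists z; split=> //; apply: ideal_mul_principal.
have sub K L : is_submodule O K -> is_submodule O L ->
    ideal_equiv O K L -> ideal_class K `<=` ideal_class L.
  move=> modK modL [z [Fz nz ->]] _ [_ [y [Fy ny ->]] <-].
  exists (scale (y * z) O).
    by exists (y * z); rewrite mulf_neq0 //; split=> //; apply: frac_fieldM.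
  by rewrite !ideal_mul_principal ?scale_scale //; apply: is_submodule_scale.
by move=> eqIJ; apply/seteqP; split; apply: sub => //; apply: ideal_equiv_sym.
Qed.

(** The pigeonhole principle through which class number 2 is exploited, and refuted when three
    inequivalent ideals are at hand. *)
Lemma card_Pic_le2 I J L : card_Pic O = 2%N ->
    invertible_ideal O I -> invertible_ideal O J -> invertible_ideal O L ->
  [\/ ideal_equiv O I J, ideal_equiv O I L | ideal_equiv O J L].
Proof.
rewrite /card_Pic => card2 invI invJ invL.
have modI := fractional_ideal_submodule invI.1.
have modJ := fractional_ideal_submodule invJ.1.
have modL := fractional_ideal_submodule invL.1.
(* [fset_set] takes the empty set as default on infinite sets, so cardinality 2 entails
   finiteness. *)
have finP : finite_set (Pic O).
  by apply: contrapT => infP; move: card2; rewrite /fset_set; case: pselect.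
have mem K : invertible_ideal O K -> ideal_class K \in fset_set (Pic O).
  by move=> invK; rewrite in_fset_set // inE; exists K.
have [eqIJ|neqIJ] := pselect (ideal_class I = ideal_class J).
  by constructor 1; apply/ideal_class_eq.
have [eqIL|neqIL] := pselect (ideal_class I = ideal_class L).
  by constructor 2; apply/ideal_class_eq.
have [eqJL|neqJL] := pselect (ideal_class J = ideal_class L).
  by constructor 3; apply/ideal_class_eq.
have uniqC : uniq [:: ideal_class I; ideal_class J; ideal_class L].
  rewrite !cons_uniq !in_cons !in_nil !orbF !negb_or !andbT -andbA.
  by apply/and3P; split; case: pselect.
have : {subset [:: ideal_class I; ideal_class J; ideal_class L] <= fset_set (Pic O)}.
  by move=> C; rewrite !in_cons in_nil orbF => /or3P[] /eqP->; apply: mem.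
by move=> /(uniq_leq_size uniqC); rewrite card2.
Qed.

Lemma card_Pic_eq2 I J : invertible_ideal O I -> invertible_ideal O J ->
    ~ ideal_equiv O I J ->
    (forall L, invertible_ideal O L -> ideal_equiv O L I \/ ideal_equiv O L J) ->
  card_Pic O = 2%N.
Proof.
move=> invI invJ neqIJ allP.
have modP K : invertible_ideal O K -> is_submodule O K.
  by case=> fracK _; apply: fractional_ideal_submodule.
have DP : Pic O = [set ideal_class I] `|` [set ideal_class J].
  apply/seteqP; split=> [_ [L [invL ->]] | C [] ->].
  - by have [] := allP L invL => eqL; [left | right]; apply/ideal_class_eq; auto.
  - by exists I.
  by exists J.
rewrite /card_Pic DP fset_setU // !fset_set1 cardfsU1 cardfs1 in_fset1.
by case: eqP => // /ideal_class_eq; case/(_ (modP _ invI) (modP _ invJ))/neqIJ.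
Qed.

End Ring.

(** * Orders of a real quadratic field *)

Definition qelt (d : nat) (a b : int) : algC := a%:~R + b%:~R * sqrtC d%:R.

(** This is Z[f sqrt d], the order of conductor f when d is squarefree and 2 or 3 mod 4;
    [quad_orderE] makes the link in the present case. *)
Definition zorder (d f : nat) : set algC :=
  [set z | exists a b : int, z = qelt d a (f%:Z * b)].

Section QuadraticOrder.

Variable d : nat.
Hypothesis d_mod4 : (d %% 4 = 3)%N.
Hypothesis d_radical : forall n : int, (d %| n ^+ 2)%Z -> (d %| n)%Z.

Local Notation w := (sqrtC (d%:R : algC)).
Local Notation qi := (qelt d).

Lemma sqrtC_sqr : w ^+ 2 = d%:R. Proof. exact: sqrtCK. Qed.

Lemma ratr_sqrtC_sqr : ratr d%:R = w ^+ 2.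
Proof. by rewrite ratr_nat sqrtC_sqr. Qed.

Lemma Aint_sqrtC : w \in Aint.
Proof.
apply: (@root_monic_Aint ('X^2 - d%:R%:P)).
- by rewrite rootE !hornerE sqrtC_sqr subrr.
- exact: monicXnsubC.
apply/polyOverP => i; rewrite coefB coefXn coefC.
by apply: rpredB; [|case: ifP => _]; rewrite ?rpred_nat ?rpred0.
Qed.

Lemma sqrtC_irrational : w \notin Crat.
Proof.
apply/negP => /Cint_rat_Aint/(_ Aint_sqrtC)/intrP[n Dn].
have /eqP : (n ^+ 2)%:~R == (Posz d)%:~R :> algC.
  by rewrite rmorphXn /= -Dn sqrtC_sqr.
move/intr_inj; case: (sqrz_mod8 n) => [[k [j [_ ->]]]|[k [_ ->]]]; lia.
Qed.

Lemma rat_sqrtC_eq0 (a b : rat) : ratr a + ratr b * w = 0 -> a = 0 /\ b = 0.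
Proof.
move=> ab0; have b0 : b = 0.
  apply: contraNeq sqrtC_irrational => nz_b.
  have -> : w = ratr (- a / b).
    have nz_rb : ratr b != 0 :> algC by rewrite fmorph_eq0.
    by rewrite rmorphM rmorphN fmorphV /=; apply: (mulfI nz_rb);
       rewrite mulrCA mulfV // mulr1; apply/eqP; rewrite -subr_eq0 opprK addrC ab0.
  exact: Crat_rat.
split=> //; move: ab0; rewrite b0 rmorph0 mul0r addr0 => /eqP.
by rewrite fmorph_eq0 => /eqP.
Qed.

Lemma qi_inj a b c e : qi a b = qi c e -> a = c /\ b = e.
Proof.
move=> /eqP; rewrite -subr_eq0 => /eqP eq0.
have [] := @rat_sqrtC_eq0 (a - c)%:~R (b - e)%:~R.
  by rewrite !ratr_int -[RHS]eq0 /qelt !rmorphB /=; ring.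
by move=> /eqP; rewrite intr_eq0 => ? /eqP; rewrite intr_eq0; lia.
Qed.

Lemma qi_int a : qi a 0 = a%:~R. Proof. by rewrite /qelt mul0r addr0. Qed.
Lemma qiD a b c e : qi a b + qi c e = qi (a + c) (b + e).
Proof. by rewrite /qelt !rmorphD /=; ring. Qed.
Lemma qiB a b c e : qi a b - qi c e = qi (a - c) (b - e).
Proof. by rewrite /qelt !rmorphB /=; ring. Qed.
Lemma qiM a b c e : qi a b * qi c e = qi (a * c + d%:Z * b * e) (a * e + b * c).
Proof.
rewrite /qelt !(rmorphD, rmorphM) /= -[(Posz d)%:~R]sqrtC_sqr; ring.
Qed.

(** The graph of the conjugation of Q(sqrt d). As a relation it is closed under sums and products,
    which suffices to carry polynomial identities across. *)
Definition qconj_pair (u v : algC) : Prop :=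
  exists a b : rat, u = ratr a + ratr b * w /\ v = ratr a - ratr b * w.

Lemma qconj_root (p : {poly algC}) (u v : algC) :
  p \is a polyOver Num.int -> qconj_pair u v -> root p u -> root p v.
Proof.
move=> /polyOverP p_int uv.
have pairD u1 v1 u2 v2 : qconj_pair u1 v1 -> qconj_pair u2 v2 ->
    qconj_pair (u1 + u2) (v1 + v2).
  move=> [a [b [-> ->]]] [c [e [-> ->]]]; exists (a + c), (b + e).
  by rewrite !rmorphD /=; split; ring.
have pairM u1 v1 u2 v2 : qconj_pair u1 v1 -> qconj_pair u2 v2 ->
    qconj_pair (u1 * u2) (v1 * v2).
  move=> [a [b [-> ->]]] [c [e [-> ->]]].
  exists (a * c + d%:R * b * e), (a * e + b * c).
  by rewrite !(rmorphD, rmorphM) /= ratr_sqrtC_sqr; split; ring.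
have pairZ (n : algC) : n \in Num.int -> qconj_pair n n.
  move=> /intrP[m ->]; exists m%:~R, 0.
  by rewrite rmorph0 mul0r subr0 addr0 ratr_int.
have pairX n : qconj_pair (u ^+ n) (v ^+ n).
  elim: n => [|n IHn]; first by apply: pairZ; apply: rpred1.
  by rewrite !exprS; apply: pairM.
have : qconj_pair p.[u] p.[v].
  rewrite !horner_coef; apply: (big_ind2 qconj_pair) => //.
    by apply: pairZ; apply: rpred0.
  by move=> i _; apply: pairM => //; apply: pairZ.
rewrite !rootE => -[a [b [-> ->]]] /eqP/rat_sqrtC_eq0[-> ->].
by rewrite rmorph0 mul0r subr0.
Qed.

(** The trace m, the norm k and N = (z - z') sqrt d are rational algebraic integers, hence integers,
    with N^2 = d (m^2 - 4k). Squarefreeness, in the form [d_radical], gives N = n d, so m^2 - 4k = d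
    n^2, and d = 3 mod 4 forces m and n to be even. *)
Lemma quad_intE : quad_int d = zorder d 1.
Proof.
apply/seteqP; split; last first.
  move=> _ [a [b ->]]; rewrite mul1r; split.
    by exists a%:~R, b%:~R; rewrite /qelt !ratr_int.
  by apply: rpredD; [|apply: rpredM]; rewrite ?Aint_sqrtC ?Aint_int.
move=> z [[a [b Dz]] Az]; rewrite /= in Az.
pose z' : algC := ratr a - ratr b * w.
have Az' : z' \in Aint.
  apply: (@root_monic_Aint (minCpoly z)); last by move: Az; rewrite unfold_in.
    apply: (@qconj_root _ z); last exact: root_minCpoly.
      by move: Az; rewrite unfold_in.
    by exists a, b.
  exact: minCpoly_monic.
have [m Dm] : exists m : int, z + z' = m%:~R.
  apply/intrP/Cint_rat_Aint; last exact: rpredD.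
  by have -> : z + z' = ratr (a + a);
     [rewrite Dz /z' rmorphD /=; ring | exact: Crat_rat].
have [k Dk] : exists k : int, z * z' = k%:~R.
  apply/intrP/Cint_rat_Aint; last exact: rpredM.
  have -> : z * z' = ratr (a * a - d%:R * (b * b)).
    by rewrite Dz /z' rmorphB !rmorphM /= ratr_sqrtC_sqr; ring.
  exact: Crat_rat.
have [N DN] : exists N : int, (z - z') * w = N%:~R.
  apply/intrP/Cint_rat_Aint; last first.
    by apply: rpredM; [apply: rpredB | exact: Aint_sqrtC].
  have -> : (z - z') * w = ratr (2 * d%:R * b).
    by rewrite Dz /z' !rmorphM /= ratr_sqrtC_sqr (ratr_nat _ 2); ring.
  exact: Crat_rat.
have DN2 : N ^+ 2 = d%:Z * (m ^+ 2 - 4 * k).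
  apply: (@intr_inj algC); rewrite rmorphXn rmorphM rmorphB rmorphXn rmorphM /=.
  rewrite -Dm -Dk -DN -[(Posz d)%:~R]sqrtC_sqr -[4%:~R]/(4%:R); ring.
have /d_radical/dvdzP[n Dn] : (d %| N ^+ 2)%Z by rewrite DN2 dvdz_mulr.
have d_gt0 : (0 < d)%N by lia.
have Dmn : m ^+ 2 - 4 * k = d%:Z * n ^+ 2.
  have nz_d : d%:Z != 0 by lia.
  by apply: (mulfI nz_d); rewrite -DN2 Dn; ring.
have nz_w : w != 0 by rewrite sqrtC_eq0 pnatr_eq0 -lt0n.
have Dzz' : z - z' = n%:~R * w.
  apply: (mulIf nz_w); rewrite DN Dn rmorphM /= -[(Posz d)%:~R]sqrtC_sqr; ring.
have [m' [n' [Dm' Dn']]] : exists m' n' : int, m = 2 * m' /\ n = 2 * n'.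
  rewrite (divn_eq d 4) d_mod4 in Dmn.
  have [[m1 [m2 [D1 D2]]]|[m1 [D1 D2]]] := sqrz_mod8 m;
    have [[n1 [n2 [E1 E2]]]|[n1 [E1 E2]]] := sqrz_mod8 n;
    move: Dmn; rewrite D2 E2 => Dmn; [lia|lia|lia|by exists m1, n1].
exists m', n'; rewrite mul1r.
have two_nz : 2 != 0 :> algC by rewrite pnatr_eq0.
apply: (mulfI two_nz); have -> : 2 * z = (z + z') + (z - z') by ring.
by rewrite Dm Dzz' Dm' Dn' /qelt !rmorphM /= -[2%:~R]/(2%:R); ring.
Qed.

Lemma quad_orderE f : quad_order d f = zorder d f.
Proof.
apply/seteqP; split=> [z [m [a]] | _ [a [b ->]]].
  rewrite quad_intE => -[[b [c ->]] ->]; exists (m + f%:Z * b), c.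
  by rewrite /qelt mul1r !(rmorphD, rmorphM) /=; ring.
exists a, (qi 0 b); rewrite quad_intE; split; first by exists 0, b; rewrite mul1r.
by rewrite /qelt rmorphM /=; ring.
Qed.

End QuadraticOrder.

(** * Extension of ideals from the order of conductor f to the maximal order *)

Section Extension.

Variable d : nat.

Local Notation w := (sqrtC (d%:R : algC)).
Local Notation qi := (qelt d).
Local Notation OK := (zorder d 1).
Local Notation O := (zorder d).

Lemma OK_qi a b : OK (qi a b). Proof. by exists a, b; rewrite mul1r. Qed.

Lemma OKP z : OK z -> exists a b, z = qi a b.
Proof. by case=> a [b]; rewrite mul1r; exists a, b. Qed.

Lemma zorder_subring f : is_subring (O f).
Proof.
split=> [|_ _ [a [b ->]] [c [e ->]]|_ _ [a [b ->]] [c [e ->]]].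
- by exists 1, 0; rewrite mulr0 qi_int.
- by exists (a - c), (b - e); rewrite qiB mulrBr.
exists (a * c + d%:Z * (f%:Z * b) * (f%:Z * e)), (a * e + b * c).
by rewrite qiM; congr qi; ring.
Qed.

Lemma zorderE f z : O f z <-> exists (n : int) v, OK v /\ z = n%:~R + f%:R * v.
Proof.
split=> [[a [b ->]] | [n [_ [/OKP[a [b ->]] ->]]]].
  by exists a, (qi 0 b); split; [exact: OK_qi | rewrite /qelt rmorphM /=; ring].
by exists (n + f%:Z * a), b; rewrite /qelt rmorphD !rmorphM /=; ring.
Qed.

Lemma zorder_sub f : O f `<=` OK.
Proof. by move=> _ [a [b ->]]; apply: OK_qi. Qed.

Let ringK := zorder_subring 1.

Section Conductor.

Variable f : nat.
Hypothesis f_gt0 : (0 < f)%N.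

Let ringO := zorder_subring f.

Lemma conductor_neq0 : f%:R != 0 :> algC. Proof. by rewrite pnatr_eq0 -lt0n. Qed.

Lemma conductor_mul v : OK v -> O f (f%:R * v).
Proof. by move=> Ov; apply/zorderE; exists 0, v; rewrite add0r. Qed.

Lemma frac_field_zorder z : frac_field OK z -> frac_field (O f) z.
Proof.
case=> a [b [Oa Ob nz ->]]; exists (f%:R * a), (f%:R * b).
rewrite mulf_neq0 ?conductor_neq0 //; split=> //; try exact: conductor_mul.
by field; rewrite nz conductor_neq0.
Qed.

Lemma is_submodule_OK I : is_submodule OK I -> is_submodule (O f) I.
Proof.
by case=> I0 ID IM; split=> // r a Or; apply: IM; apply: zorder_sub Or.
Qed.

Lemma zorder_mul_OK : ideal_mul (O f) OK = OK.
Proof.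
rewrite ideal_mulC; apply: (ideal_mul_ring ringO).
exact/is_submodule_OK/is_submodule_self.
Qed.

Lemma is_submodule_extend I : is_submodule OK (ideal_mul I OK).
Proof. by rewrite ideal_mulC; apply/is_submodule_mul/is_submodule_self. Qed.

(** If I J = O_f, then the extensions of I and J are inverse to each other; this is the map Pic(O_f)
    -> Pic(O_K) on representatives. *)
Lemma invertible_extend I :
  invertible_ideal (O f) I -> invertible_ideal OK (ideal_mul I OK).
Proof.
have frac_extend J : fractional_ideal (O f) J -> fractional_ideal OK (ideal_mul J OK).
  case=> _ _ _ _ [c [Oc nz_c OcJ]].
  apply: (@fractional_idealP OK _ c) => //; first exact: is_submodule_extend.
    exact: zorder_sub Oc.
  apply: ideal_mul_sub; first by rewrite mulr0; apply: ring0.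
    by move=> a b Oa Ob; rewrite mulrDr; apply: ringD.
  by move=> a b Ja Ob; rewrite mulrA; apply: ringM => //; apply/zorder_sub/OcJ.
move=> [fracI [J [fracJ IJ]]]; split; first exact: frac_extend.
exists (ideal_mul J OK); split; first exact: frac_extend.
rewrite ideal_mulACA IJ (ideal_mul_ring ringK) ?zorder_mul_OK //.
exact: is_submodule_self.
Qed.

Lemma scale_unit z : ring_units OK z -> scale z OK = OK.
Proof.
move=> [Oz [v [Ov zv]]]; apply/seteqP; split=> [_ [a Oa <-] | a Oa].
  exact: ringM.
by exists (v * a); [apply: ringM | rewrite mulrA zv mul1r].
Qed.

Lemma scale_OK_unit z : scale z OK = OK -> ring_units OK z.
Proof.
move=> zOK; split; first by have := scale_mem z (ring1 ringK); rewrite zOK mulr1.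
by have := ring1 ringK; rewrite -{1}zOK => -[v Ov zv]; exists v.
Qed.

(* For u invertible modulo f, these are the ideals of O f that become trivial *)
(* in the maximal order.                                                      *)
Definition ker_ideal (u : algC) : set algC :=
  [set z | exists (n : int) v, OK v /\ z = n%:~R * u + f%:R * v].

Lemma ker_ideal_gen u : ker_ideal u u.
Proof. by exists 1, 0; rewrite mul1r mulr0 addr0; split=> //; apply: ring0. Qed.

Lemma ker_ideal_conductor u v : OK v -> ker_ideal u (f%:R * v).
Proof. by move=> Ov; exists 0, v; rewrite mul0r add0r. Qed.

Lemma is_submodule_ker u : OK u -> is_submodule (O f) (ker_ideal u).
Proof.
move=> Ou; split.
- by rewrite -(mulr0 f%:R); apply: ker_ideal_conductor; apply: (ring0 ringK).
- move=> _ _ [n [a [Oa ->]]] [m [b [Ob ->]]].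
  by exists (n + m), (a + b); rewrite rmorphD /=; split; [apply: ringD | ring].
move=> _ _ /zorderE[m [b [Ob ->]]] [n [a [Oa ->]]].
exists (m * n), (m%:~R * a + n%:~R * u * b + f%:R * a * b).
split; last by rewrite rmorphM /=; ring.
have Oint k := ring_int ringK k.
by do !apply: (ringD ringK); do !apply: (ringM ringK) => //; apply: Oint f%:Z.
Qed.

Section UnitModConductor.

Variables u u' t : algC.
Hypotheses (Ou : OK u) (Ou' : OK u') (Ot : OK t) (uu' : u * u' = 1 + f%:R * t).

Lemma ker_extend : ideal_mul (ker_ideal u) OK = OK.
Proof.
apply/seteqP; split.
  apply: ideal_mul_sub; [exact: ring0 | exact: ringD |].
  move=> _ b [n [a [Oa ->]]] Ob; apply: (ringM ringK) => //.
  have Oint k := ring_int ringK k.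
  by apply: (ringD ringK); apply: (ringM ringK) => //; apply: Oint f%:Z.
have [_ _ modM] := is_submodule_extend (ker_ideal u).
have [_ extD _] := is_submodule_extend (ker_ideal u).
suff ext1 : ideal_mul (ker_ideal u) OK 1.
  by move=> z Oz; rewrite -[z]mulr1; apply: modM.
have -> : 1 = u * u' + f%:R * - t by rewrite uu' mulrN addrK.
apply: extD; first by apply: ideal_mul_mem => //; apply: ker_ideal_gen.
rewrite -[_ * - t]mulr1; apply: ideal_mul_mem; last exact: ring1.
by apply: ker_ideal_conductor; apply: ringN.
Qed.

Lemma fractional_ker : fractional_ideal (O f) (ker_ideal u).
Proof.
apply: (@fractional_idealP _ _ f%:R); first exact: is_submodule_ker.
- exact: ring_int ringO f%:Z.
- exact: conductor_neq0.
move=> _ [n [a [Oa ->]]]; apply: conductor_mul.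
have Oint k := ring_int ringK k.
by apply: (ringD ringK); apply: (ringM ringK) => //; apply: Oint f%:Z.
Qed.

End UnitModConductor.

(** The inverse is the ideal attached to u', the inverse of u modulo f. *)
Lemma ker_invertible u u' t : OK u -> OK u' -> OK t -> u * u' = 1 + f%:R * t ->
  invertible_ideal (O f) (ker_ideal u).
Proof.
move=> Ou Ou' Ot uu'; split; first exact: fractional_ker.
exists (ker_ideal u'); split; first exact: fractional_ker.
have Oint k := ring_int ringK k; have Of : OK f%:R := Oint f%:Z.
apply/seteqP; split.
  apply: ideal_mul_sub; [exact: ring0 | exact: ringD |].
  move=> _ _ [n [a [Oa ->]]] [m [b [Ob ->]]]; apply/zorderE.
  exists (n * m), (n%:~R * m%:~R * t + n%:~R * u * b + m%:~R * u' * a + f%:R * a * b).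
  split; first by do !apply: (ringD ringK); do !apply: (ringM ringK) => //; apply: Oint.
  transitivity (n%:~R * m%:~R * (u * u')
    + f%:R * (n%:~R * u * b + m%:~R * u' * a + f%:R * a * b)).
    by ring.
  by rewrite uu' rmorphM /=; ring.
have [_ prodD prodM] := is_submodule_mul (ker_ideal u') (is_submodule_ker Ou).
have prod_f v : OK v -> ideal_mul (ker_ideal u) (ker_ideal u') (f%:R * v).
  (* This is f v (u u' - f t), as u u' - f t = 1; both terms are visibly in the product. *)
  move=> Ov; have -> : f%:R * v = u * (f%:R * (v * u')) - f%:R * (f%:R * (v * t)).
    transitivity (f%:R * v * (u * u') - f%:R * (f%:R * (v * t))); last by ring.
    by rewrite uu'; ring.
  rewrite -mulrN; apply: prodD; apply: ideal_mul_mem.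
  - exact: ker_ideal_gen.
  - by apply: ker_ideal_conductor; apply: ringM.
  - by rewrite -[f%:R]mulr1; apply: ker_ideal_conductor; apply: ring1.
  by rewrite -mulrN; apply: ker_ideal_conductor; apply: ringN => //; apply: ringM.
suff prod1 : ideal_mul (ker_ideal u) (ker_ideal u') 1.
  by move=> z Oz; rewrite -[z]mulr1; apply: prodM.
have -> : 1 = u * u' + f%:R * - t by rewrite uu' mulrN addrK.
apply: prodD; last by apply: prod_f; apply: ringN.
by apply: ideal_mul_mem; apply: ker_ideal_gen.
Qed.

End Conductor.

End Extension.

(** * Ideals with two generators, prime to the conductor *)

Section GenIdeal.

Variable d : nat.
Hypothesis d_mod4 : (d %% 4 = 3)%N.

Local Notation w := (sqrtC (d%:R : algC)).
Local Notation qi := (qelt d).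
Local Notation OK := (zorder d 1).
Local Notation O := (zorder d).

Let ringK := zorder_subring d 1.

Definition qnorm (a b : int) : int := a ^+ 2 - d%:Z * b ^+ 2.

Lemma qi_conj a b : qi a b * qi a (- b) = (qnorm a b)%:~R.
Proof. by rewrite -(qi_int d) qiM /qnorm; congr qi; ring. Qed.

Lemma qnormM a b c e :
  qnorm (a * c + d%:Z * b * e) (a * e + b * c) = qnorm a b * qnorm c e.
Proof. by rewrite /qnorm; ring. Qed.

Lemma qnorm_mul a b c e g h :
  qi a b * qi c e = qi g h -> qnorm a b * qnorm c e = qnorm g h.
Proof. by rewrite qiM => /(qi_inj d_mod4)[<- <-]; rewrite qnormM. Qed.

Lemma qnorm_int n : qnorm n 0 = n ^+ 2.
Proof. by rewrite /qnorm; ring. Qed.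

Section Gen.

Variables (f : nat) (n r t m : int).
Hypotheses (f_gt0 : (0 < f)%N) (nz_n : n != 0).
Hypothesis norm_nm : qnorm r t = n * m.
(* The ideal n O + f (r + t sqrt d) O and its conjugate have product n O.     *)
Hypothesis bezout : exists u v e : int,
  u * n + v * (f%:Z * (2 * r)) + e * (f%:Z ^+ 2 * m) = 1.

Let ringO := zorder_subring d f.

(** The factor f brings the second generator into O_f. The parameter b takes the values t and -t, so
    that the conjugate ideal has the same description. *)
Definition gen_ideal (b : int) : set algC :=
  [set z | exists u v, [/\ O f u, O f v & z = n%:~R * u + f%:R * qi r b * v]].

Lemma gen_mem1 b : gen_ideal b n%:~R.
Proof.
exists 1, 0; split; [exact: ring1 ringO | exact: ring0 ringO | ].
by rewrite mulr0 mulr1 addr0.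
Qed.

Lemma gen_mem2 b : gen_ideal b (f%:R * qi r b).
Proof.
exists 0, 1; split; [exact: ring0 ringO | exact: ring1 ringO | ].
by rewrite mulr0 mulr1 add0r.
Qed.

Lemma is_submodule_gen b : is_submodule (O f) (gen_ideal b).
Proof.
split.
- exists 0, 0; split; [exact: ring0 ringO | exact: ring0 ringO | ].
  by rewrite !mulr0 addr0.
- move=> _ _ [u [v [Ou Ov ->]]] [u' [v' [Ou' Ov' ->]]].
  by exists (u + u'), (v + v'); split; [exact: ringD | exact: ringD | ring].
move=> c _ Oc [u [v [Ou Ov ->]]].
by exists (c * u), (c * v); split; [exact: ringM | exact: ringM | ring].
Qed.

Lemma gen_sub b : gen_ideal b `<=` O f.
Proof.
move=> _ [u [v [Ou Ov ->]]]; apply: (ringD ringO); apply: (ringM ringO) => //.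
  exact: (ring_int ringO).
exact/conductor_mul/OK_qi.
Qed.

Lemma fractional_gen b : fractional_ideal (O f) (gen_ideal b).
Proof.
apply: (@fractional_idealP _ _ 1); first exact: is_submodule_gen.
- exact: ring1 ringO.
- exact: oner_neq0.
by move=> a /gen_sub; rewrite mul1r.
Qed.

Lemma intr_n : n%:~R != 0 :> algC. Proof. by rewrite intr_eq0. Qed.

(** The inverse is the conjugate ideal divided by n. Products of generators are multiples of n
    because r + t sqrt d has norm n m; conversely [bezout], multiplied by n, writes n in terms of
    n^2, the trace term 2 f r n and f^2 n m. *)
Lemma gen_invertible : invertible_ideal (O f) (gen_ideal t).
Proof.
split; first exact: fractional_gen.
exists (scale n%:~R^-1 (gen_ideal (- t))); split.
  apply: (fractional_ideal_scale ringO); last exact: fractional_gen.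
  apply: (frac_fieldV intr_n); apply: (frac_field_mem ringO).
  exact: (ring_int ringO).
rewrite ideal_mulC ideal_mul_scale.
set P := ideal_mul _ _.
have [P0 PD PM] : is_submodule (O f) P by apply/is_submodule_mul/is_submodule_gen.
have norm_C : qi r t * qi r (- t) = n%:~R * m%:~R.
  by rewrite qi_conj norm_nm rmorphM.
have Oint k := ring_int ringO k.
have Oqi b : O f (f%:R * qi r b) by apply/conductor_mul/OK_qi.
apply/seteqP; split.
  move=> _ [z Pz <-]; suff [y Oy ->] : exists2 y, O f y & z = n%:~R * y.
    by rewrite mulKf ?intr_n.
  move: z Pz; apply: ideal_mul_sub.
  - by exists 0; rewrite ?mulr0 //; exact: (ring0 ringO).
  - move=> _ _ [y Oy ->] [y' Oy' ->].
    by exists (y + y'); [exact: ringD | rewrite mulrDr].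
  move=> _ _ [u [v [Ou Ov ->]]] [u' [v' [Ou' Ov' ->]]].
  exists (n%:~R * u * u' + f%:R * qi r t * u * v' + f%:R * qi r (- t) * v * u'
          + f%:R * f%:R * m%:~R * (v * v')).
    by do !apply: (ringD ringO);
      do ![exact: Oqi | done | exact: (Oint f%:Z) | apply: (ringM ringO)].
  transitivity (n%:~R * (n%:~R * u * u' + f%:R * qi r t * u * v'
     + f%:R * qi r (- t) * v * u') + f%:R * f%:R * (qi r t * qi r (- t)) * (v * v')).
    by ring.
  by rewrite norm_C; ring.
suff Pn : P n%:~R.
  move=> z Oz; exists (z * n%:~R); first exact: PM.
  by rewrite mulrC mulfK ?intr_n.
have [u [v [e bez]]] := bezout.
have -> : n%:~R = u%:~R * (n%:~R * n%:~R)
    + v%:~R * (f%:R * qi r (- t) * n%:~R + n%:~R * (f%:R * qi r t))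
    + e%:~R * ((f%:R * qi r (- t)) * (f%:R * qi r t)).
  transitivity (n%:~R * (u * n + v * (f%:Z * (2 * r)) + e * (f%:Z ^+ 2 * m))%:~R : algC).
    by rewrite bez mulr1.
  transitivity (u%:~R * (n%:~R * n%:~R)
    + v%:~R * (f%:R * qi r (- t) * n%:~R + n%:~R * (f%:R * qi r t))
    + e%:~R * (f%:R * f%:R * (qi r t * qi r (- t)))); last by ring.
  by rewrite norm_C /qelt; ring.
apply: (PD); first apply: (PD); apply: PM => //.
- by apply: ideal_mul_mem; apply: gen_mem1.
- by apply: (PD); apply: ideal_mul_mem; (exact: gen_mem1 || exact: gen_mem2).
by apply: ideal_mul_mem; apply: gen_mem2.
Qed.

Lemma gen_extend_sub z : ideal_mul (gen_ideal t) OK z ->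
  exists u v, [/\ OK u, OK v & z = n%:~R * u + f%:R * qi r t * v].
Proof.
move: z; apply: ideal_mul_sub.
- exists 0, 0; split; [exact: ring0 ringK | exact: ring0 ringK | ].
  by rewrite !mulr0 addr0.
- move=> _ _ [u [v [Ou Ov ->]]] [u' [v' [Ou' Ov' ->]]].
  by exists (u + u'), (v + v'); split; [exact: ringD | exact: ringD | ring].
move=> _ c [u [v [/zorder_sub Ou /zorder_sub Ov ->]]] Oc.
by exists (u * c), (v * c); split; [exact: ringM | exact: ringM | ring].
Qed.

Lemma gen_extend_norm a b :
  ideal_mul (gen_ideal t) OK (qi a b) -> (n %| qnorm a b)%Z.
Proof.
case/gen_extend_sub=> _ [_ [/OKP[a1 [b1 ->]] /OKP[a2 [b2 ->]]]].
have -> : n%:~R * qi a1 b1 + f%:R * qi r t * qi a2 b2 =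
    qi (n * a1 + f%:Z * (r * a2 + d%:Z * t * b2))
       (n * b1 + f%:Z * (r * b2 + t * a2)).
  by rewrite -mulrA qiM /qelt !(rmorphD, rmorphM) /=; ring.
case/(qi_inj d_mod4)=> -> ->; apply/dvdzP.
exists (n * qnorm a1 b1 + 2 * f%:Z * (a1 * (r * a2 + d%:Z * t * b2)
  - d%:Z * b1 * (r * b2 + t * a2)) + f%:Z ^+ 2 * m * qnorm a2 b2).
transitivity (n * (n * qnorm a1 b1 + 2 * f%:Z * (a1 * (r * a2 + d%:Z * t * b2)
   - d%:Z * b1 * (r * b2 + t * a2))) + f%:Z ^+ 2 * qnorm r t * qnorm a2 b2).
  by rewrite /qnorm; ring.
by rewrite norm_nm; ring.
Qed.

(* A generator c of the extended ideal I satisfies I * conj I = (n), so its   *)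
(* norm is n up to sign, and then qi r t / c has norm m up to sign.           *)
Lemma gen_extend_principal c : ideal_mul (gen_ideal t) OK = scale c OK ->
  (exists a b : int, `|qnorm a b| = `|n|) /\ (exists a b : int, `|qnorm a b| = `|m|).
Proof.
move=> Ic.
have ext z u : gen_ideal t z -> OK u -> exists2 v, OK v & c * v = z * u.
  by move=> Iz Ou; have : scale c OK (z * u) by rewrite -Ic; apply: ideal_mul_mem.
have [_ /OKP[a3 [b3 ->]]] := ext _ _ (gen_mem1 t) (ring1 ringK).
rewrite mulr1 => D3.
have [_ /OKP[a4 [b4 ->]]] := ext _ _ (gen_mem2 t) (ring1 ringK).
rewrite mulr1 => D4.
have [u [v [e bez]]] := bezout.
have Icc : ideal_mul (gen_ideal t) OK c.
  by have := scale_mem c (ring1 ringK); rewrite Ic mulr1.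
have [u0 [v0 [Ou0 Ov0 Dc]]] := gen_extend_sub Icc.
have [a [b Dab]] : exists a b, c = qi a b.
  apply: OKP; rewrite Dc; apply: (ringD ringK); last apply: (ringM ringK) => //.
    by apply: (ringM ringK) => //; apply: (ring_int ringK).
  by apply: (ringM ringK); [apply: (ring_int ringK f%:Z) | apply: OK_qi].
have [h Dh] : exists h : int, qnorm a b = n * h.
  have /dvdzP[h Dh] : (n %| qnorm a b)%Z by apply: gen_extend_norm; rewrite -Dab.
  by exists h; rewrite Dh mulrC.
rewrite {c Ic Icc Dc ext}Dab in D3 D4.
have [a5 [b5 D5]] : exists a5 b5, qi a b * qi a5 b5 = qi r t.
  (* Multiplying [bezout] by r + t sqrt d writes it as u n (r + t sqrt d) + s f (r + t sqrt d),
     where n and f (r + t sqrt d) are multiples of the generator. *)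
  pose s := v * (2 * r) + e * f%:Z * m.
  have /OKP[a5 [b5 D5]] :
      OK (u%:~R * (qi a3 b3 * qi r t) + s%:~R * qi a4 b4).
    by apply: (ringD ringK); do ![exact: (ring_int ringK) | exact: OK_qi
      | apply: (ringM ringK)].
  exists a5, b5; rewrite -D5.
  transitivity (u%:~R * (qi a b * qi a3 b3) * qi r t
    + s%:~R * (qi a b * qi a4 b4)); first by ring.
  rewrite D3 D4 -[RHS]mul1r -[1 in RHS]/(1%:~R) -bez /s; ring.
have N3 : n * h * qnorm a3 b3 = n ^+ 2.
  by rewrite -Dh -qnorm_int; apply: qnorm_mul; rewrite D3 qi_int.
have N5 : n * h * qnorm a5 b5 = n * m by rewrite -Dh -norm_nm; apply: qnorm_mul.
have {}N3 : h * qnorm a3 b3 = n by apply: (mulfI nz_n); rewrite mulrA N3.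
have {}N5 : h * qnorm a5 b5 = m by apply: (mulfI nz_n); rewrite mulrA N5.
have [r' Dr] : exists r', r = h * r'.
  have D3' : qi a (- b) * qi a3 (- b3) = n%:~R.
    move/esym: D3; rewrite -(qi_int d) !qiM => /(qi_inj d_mod4)[Dn D0].
    by congr qi; [rewrite Dn; ring | rewrite -oppr0 D0; ring].
  have Drt : qi r t = h%:~R * (qi a3 (- b3) * qi a5 b5).
    apply: (mulfI intr_n); rewrite -{1}D3' -D5.
    transitivity (qi a b * qi a (- b) * (qi a3 (- b3) * qi a5 b5)); first by ring.
    by rewrite qi_conj Dh; ring.
  move: Drt; rewrite -(qi_int d h) !qiM => /(qi_inj d_mod4)[-> _].
  by eexists; rewrite mulr0 mul0r addr0.
(* The integer h divides n, m and r, hence the left side of [bezout]. *)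
have h1 : `|h| = 1.
  have : h * (u * qnorm a3 b3 + v * f%:Z * 2 * r' + e * f%:Z ^+ 2 * qnorm a5 b5) = 1.
    transitivity (u * (h * qnorm a3 b3) + v * (f%:Z * (2 * (h * r')))
      + e * (f%:Z ^+ 2 * (h * qnorm a5 b5))); first by ring.
    by rewrite N3 N5 -Dr.
  move=> h1; suff: (h %| 1)%Z by rewrite dvdz1 => /eqP Dh1; rewrite -abszE Dh1.
  by apply/dvdzP; eexists; rewrite -[LHS]h1; apply: mulrC.
split; first by exists a, b; rewrite Dh normrM h1 mulr1.
by exists a5, b5; rewrite -N5 normrM h1 mul1r.
Qed.

End Gen.

End GenIdeal.

(** * The kernel of the extension map, described by units *)

Section Units.

Variable d : nat.
Hypothesis d_mod4 : (d %% 4 = 3)%N.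

Local Notation w := (sqrtC (d%:R : algC)).
Local Notation qi := (qelt d).
Local Notation OK := (zorder d 1).
Local Notation O := (zorder d).

Let ringK := zorder_subring d 1.

Variable eps : algC.
Hypothesis unitsE : ring_units OK = [set u | exists k : int, u = eps ^ k \/ u = - eps ^ k].

Lemma eps_unit (k : int) : ring_units OK (eps ^ k).
Proof. by rewrite unitsE; exists k; left. Qed.

(** The scaling factor maps O_K onto itself, since both ideals extend to O_K; hence it is a power of
    eps up to a sign, which the integer n absorbs. *)
Lemma ker_equiv f u v u' v' t t' : (0 < f)%N ->
    OK u -> OK u' -> OK t -> u * u' = 1 + f%:R * t ->
    OK v -> OK v' -> OK t' -> v * v' = 1 + f%:R * t' ->
    ideal_equiv (O f) (ker_ideal d f u) (ker_ideal d f v) ->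
  exists (k n : int) (s : algC), OK s /\ u = eps ^ k * (n%:~R * v) + f%:R * s.
Proof.
move=> f_gt0 Ou Ou' Ot uu' Ov Ov' Ot' vv' [c [_ nz_c Duv]].
have c_unit : ring_units OK c.
  apply: scale_OK_unit; rewrite -{1}(ker_extend Ov Ov' Ot' vv').
  by rewrite -ideal_mul_scale -Duv (ker_extend Ou Ou' Ot uu').
have := ker_ideal_gen d f u; rewrite Duv => -[_ [n [s [Os ->]]] Du].
have [Oc _] := c_unit.
move: c_unit; rewrite unitsE => -[k [Dc|Dc]].
  exists k, n, (c * s); split; first exact: ringM.
  by rewrite -Du -Dc; ring.
exists k, (- n), (c * s); split; first exact: ringM.
by rewrite -Du [in LHS]mulrDr {1}Dc rmorphN /=; ring.
Qed.

Section Injectivity.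

(** In the applications P is the prime ideal of O_K above a ramified prime l, and [units_mod] says
    that integers and powers of eps exhaust the units of O_K modulo l. *)
Variables (l : nat) (P : set algC).
Hypothesis l_prime : prime l.
Hypotheses (P0 : P 0) (PD : forall a b, P a -> P b -> P (a + b)).
Hypotheses (PM : forall a b, P a -> OK b -> P (a * b)) (P1 : ~ P 1).
Hypothesis units_mod : forall z, OK z -> ~ P z ->
  exists (k m : int) v, OK v /\ eps ^ k = m%:~R * z + l%:R * v.

Let l_gt0 : (0 < l)%N := prime_gt0 l_prime.
Let ringO := zorder_subring d l.

Lemma extend_conductor I v : is_submodule (O l) I -> ideal_mul I OK = OK ->
  OK v -> I (l%:R * v).
Proof.
move=> [I0 ID IM] IK Ov.
suff sub z : ideal_mul I OK z -> I (l%:R * v * z).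
  by rewrite -[_ * v]mulr1; apply: sub; rewrite IK; apply: (ring1 ringK).
move: z; apply: ideal_mul_sub.
- by rewrite mulr0.
- by move=> a b Ia Ib; rewrite mulrDr; apply: ID.
move=> a b Ia Ob; have -> : l%:R * v * (a * b) = l%:R * (v * b) * a by ring.
by apply: (IM) => //; apply: conductor_mul; apply: (ringM ringK).
Qed.

(** O_l has prime index l in O_K, so an ideal strictly between or above could only be O_K. Then I J
    = O_l would be stable under multiplication by sqrt d, which is absurd. *)
Lemma extend_trivial_eq I J : is_submodule (O l) I -> ideal_mul I J = O l ->
  ideal_mul I OK = OK -> I 1 -> I = O l.
Proof.
move=> modI IJ IK I1; have [I0 ID IM] := modI.
have IO z : O l z -> I z by move=> Oz; rewrite -[z]mulr1; apply: IM.
have I_OK z : I z -> OK z.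
  by move=> Iz; rewrite -IK -[z]mulr1; apply: ideal_mul_mem => //; apply: (ring1 ringK).
apply/seteqP; split=> // z Iz; have /OKP[a [b Dz]] := I_OK z Iz.
have [/dvdzP[b' Db]|l_b] := boolP (l %| b)%Z.
  by exists a, b'; rewrite Dz Db mulrC.
have Iw : I w.
  have : coprimez l b by rewrite /coprimez eqz_nat -/(coprime l `|b|) prime_coprime.
  move=> /coprimezP[[u v] /= uv].
  have -> : w = l%:R * (u%:~R * w) + (v%:~R * z + (- (v * a))%:~R).
    transitivity ((u * l%:Z + v * b)%:~R * w); first by rewrite uv mul1r.
    by rewrite Dz /qelt; ring.
  have Ow : OK w by have := OK_qi d 0 1; rewrite /qelt mul1r add0r.
  apply: (ID); first apply: extend_conductor => //.
    by apply: (ringM ringK) => //; apply: (ring_int ringK).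
  apply: (ID); first by apply: (IM) => //; apply: (ring_int ringO).
  by apply: IO; apply: (ring_int ringO).
have I_qi c e : I (qi c e).
  rewrite /qelt; apply: (ID); first by apply: IO; apply: (ring_int ringO).
  by apply: (IM) => //; apply: (ring_int ringO).
have : O l (w * 1).
  rewrite -IJ; apply: ideal_mul_closed; last by rewrite IJ; apply: (ring1 ringO).
  move=> x /I_OK /OKP[c [e ->]]; have -> : w = qi 0 1.
    by rewrite /qelt mul1r add0r.
  by rewrite qiM; apply: I_qi.
rewrite mulr1 => -[c [e]]; have {1}-> : w = qi 0 1.
  by rewrite /qelt mul1r add0r.
move=> /(qi_inj d_mod4)[_ De].
have : (l %| 1)%Z by apply/dvdzP; exists e; rewrite mulrC -De.
by rewrite dvdzE /= dvdn1 => /eqP l1; move: l_prime; rewrite l1.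
Qed.

(** Injectivity of Pic(O_l) -> Pic(O_K). After division by c the ideal extends to O_K, so it has an
    element outside P; as it also contains l O_K, it contains a power of eps. Dividing by that power
    reduces to [extend_trivial_eq]. *)
Lemma extend_principal I J c : is_submodule (O l) I -> ideal_mul I J = O l ->
    ideal_mul I OK = scale c OK -> frac_field OK c -> c != 0 ->
  ideal_equiv (O l) I (O l).
Proof.
move=> modI IJ IK Fc nz_c.
pose I1 := scale c^-1 I.
have modI1 : is_submodule (O l) I1 by apply: is_submodule_scale.
have I1K : ideal_mul I1 OK = OK by rewrite ideal_mul_scale IK scaleVK.
have [z I1z Pz] : exists2 z, I1 z & ~ P z.
  apply: contrapT => noz; apply: P1.
  have : ideal_mul I1 OK 1 by rewrite I1K; apply: (ring1 ringK).
  move: (1 : algC); apply: ideal_mul_sub => // a b Ia Ob; apply: PM => //.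
  by apply: contrapT => Pa; apply: noz; exists a.
have Oz : OK z.
  by rewrite -I1K -[z]mulr1; apply: ideal_mul_mem => //; apply: (ring1 ringK).
have [k [m [v [Ov Dk]]]] := units_mod Oz Pz.
have I1k : I1 (eps ^ k).
  rewrite Dk; case: (modI1) => _ ID IM; apply: ID.
    by apply: (IM) => //; apply: (ring_int ringO).
  exact: extend_conductor.
have nz_k : eps ^ k != 0.
  have [_ [u [_ ku]]] := eps_unit k; apply: contraTneq (oner_neq0 algC) => k0.
  by rewrite -ku k0 mul0r eqxx.
pose y := c * eps ^ k.
have nz_y : y != 0 by rewrite mulf_neq0.
have DI : scale y^-1 I = O l.
  apply: (@extend_trivial_eq _ (scale y J)).
  - exact: is_submodule_scale.
  - rewrite ideal_mul_scale ideal_mulC ideal_mul_scale scaleVK //.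
    by rewrite ideal_mulC.
  - rewrite ideal_mul_scale IK /y invfM mulrC -scale_scale.
    by rewrite scaleVK // -{1}(scale_unit (eps_unit k)) scaleVK.
  have := scale_mem (eps ^ k)^-1 I1k.
  by rewrite mulVf // scale_scale -invfM mulrC.
exists y; split=> //; last by rewrite -DI scaleKV.
apply: frac_field_zorder => //; apply: (frac_fieldM ringK) => //.
by apply: (frac_field_mem ringK); case: (eps_unit k).
Qed.

(** The classes are those of O_l and of A, the ideal with a nonprincipal extension: for any
    invertible L, the extension of L or of L times the inverse of A is principal, and
    [extend_principal] descends this to O_l. *)
Lemma card_Pic_prime (n r t m : int) : card_Pic OK = 2%N ->
    n != 0 -> qnorm d r t = n * m ->
    (exists u v e : int,
       u * n + v * (l%:Z * (2 * r)) + e * (l%:Z ^+ 2 * m) = 1) ->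
    (forall c, ideal_mul (gen_ideal d l n r t) OK <> scale c OK) ->
  card_Pic (O l) = 2%N.
Proof.
move=> h2 nz_n norm_nm bez nonprinc; set A := gen_ideal d l n r t.
have invA : invertible_ideal (O l) A by exact: gen_invertible norm_nm bez.
have [_ [B [_ AB]]] := invA.
have modO := is_submodule_self ringO.
apply: (@card_Pic_eq2 _ ringO (O l) A) => //; first exact: invertible_ideal_ring.
  move=> /ideal_equiv_sym[z [_ nz Dz]]; apply: (nonprinc z).
  by rewrite -/A Dz ideal_mul_scale zorder_mul_OK.
move=> L invL; have modL := fractional_ideal_submodule invL.1.
have [_ [J [_ LJ]]] := invL.
have [eqKA | eqKL | eqAL] := card_Pic_le2 ringK h2 (invertible_ideal_ring ringK)
  (invertible_extend invA) (invertible_extend invL).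
- by case: (ideal_equiv_sym eqKA) => z [_ _ /nonprinc].
- left; have [z [Fz nz Dz]] := ideal_equiv_sym eqKL.
  exact: extend_principal modL LJ Dz Fz nz.
right; have [z [Fz nz Dz]] := ideal_equiv_sym eqAL.
have modLB : is_submodule (O l) (ideal_mul L B) by apply: is_submodule_mul.
have LBK : ideal_mul (ideal_mul L B) OK = scale z OK.
  rewrite -ideal_mulA (ideal_mulC B) ideal_mulA Dz ideal_mul_scale.
  by rewrite -ideal_mulA (ideal_mulC OK) ideal_mulA AB zorder_mul_OK.
have LBJA : ideal_mul (ideal_mul L B) (ideal_mul J A) = O l.
  by rewrite ideal_mulACA LJ (ideal_mulC B) AB ideal_mul_ring.
have [y [Fy ny Dy]] := extend_principal modLB LBJA LBK Fz nz.
exists y; split=> //; rewrite -(ideal_mul_ring ringO modL) -AB.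
rewrite (ideal_mulC A) ideal_mulA Dy ideal_mul_scale ideal_mulC.
by rewrite ideal_mul_ring //; apply: fractional_ideal_submodule invA.1.
Qed.

End Injectivity.

End Units.

(** * The field generated by the square root of pq *)

Section PrimePair.

Variables (p q : nat).
Hypotheses (p_prime : prime p) (q_prime : prime q).
Hypotheses (p_mod4 : (p %% 4 = 1)%N) (q_mod4 : (q %% 4 = 3)%N).

Let d := (p * q)%N.

Local Notation w := (sqrtC (d%:R : algC)).
Local Notation qi := (qelt d).
Local Notation OK := (zorder d 1).
Local Notation O := (zorder d).

Let ringK := zorder_subring d 1.

Lemma prime_pair_neq : p != q.
Proof. by apply: contra_eqN p_mod4 => /eqP->; rewrite q_mod4. Qed.

Lemma pq_mod4 : (d %% 4 = 3)%N.
Proof. by rewrite /d -modnMml p_mod4 mul1n. Qed.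
Let d_mod4 := pq_mod4.

Lemma pq_coprimez : coprimez p q.
Proof.
rewrite /coprimez eqz_nat -/(coprime p q) prime_coprime // dvdn_prime2 //.
exact: prime_pair_neq.
Qed.

Lemma pq_radical (n : int) : (d %| n ^+ 2)%Z -> (d %| n)%Z.
Proof.
rewrite /d PoszM !Gauss_dvdz ?pq_coprimez //.
by rewrite !Euclid_dvdzX.
Qed.

(* These say that, among the ramified prime ideals of the maximal order, the  *)
(* one above p, the one above 2, and their product, respectively, is          *)
(* principal.                                                                 *)
Definition form_repr1 := exists a b : int, `|p%:Z * a ^+ 2 - q%:Z * b ^+ 2| = 1.
Definition norm_repr2 := exists a b : int, `|qnorm d a b| = 2.
Definition form_repr2 := exists a b : int, `|p%:Z * a ^+ 2 - q%:Z * b ^+ 2| = 2.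

(** If the prime above p and its product with the prime above 2 are both principal, so is the prime
    above 2; in terms of forms this is a composition identity. *)
Lemma form_repr_mul : form_repr1 -> form_repr2 -> norm_repr2.
Proof.
move=> [a [b A]] [c [e C]].
exists (p%:Z * a * c + q%:Z * b * e), (a * e + b * c).
have := congr2 *%R A C; rewrite mul1r => <-; rewrite -normrM; congr `|_|.
by rewrite /qnorm /d PoszM; ring.
Qed.

Lemma qnorm_p_form_repr1 a b : qnorm d a b = p%:Z \/ qnorm d a b = - p%:Z -> form_repr1.
Proof.
move=> Dab; have nz_p : p%:Z != 0 by rewrite eqz_nat -lt0n prime_gt0.
have : (p %| a ^+ 2)%Z.
  have -> : a ^+ 2 = qnorm d a b + p%:Z * (q%:Z * b ^+ 2).
    by rewrite /qnorm /d PoszM; ring.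
  by rewrite rpredD ?dvdz_mulr //; case: Dab => ->; rewrite ?rpredN.
rewrite Euclid_dvdzX // => /dvdzP[a' Da]; exists a', b.
have Dn : qnorm d a b = p%:Z * (p%:Z * a' ^+ 2 - q%:Z * b ^+ 2).
  by rewrite /qnorm Da /d PoszM; ring.
suff [->|->] : p%:Z * a' ^+ 2 - q%:Z * b ^+ 2 = 1 \/
  p%:Z * a' ^+ 2 - q%:Z * b ^+ 2 = -1 by [].
by case: Dab => Dab; [left|right]; apply: (mulfI nz_p); rewrite -Dn Dab; ring.
Qed.

Section Nonprincipal.

Variable f : nat.

Lemma bezout_p : ~~ (p %| f)%N -> exists u v e : int,
  u * p%:Z + v * (f%:Z * (2 * 0)) + e * (f%:Z ^+ 2 * - q%:Z) = 1.
Proof.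
move=> p_f; have : coprimez p (f%:Z ^+ 2 * q%:Z).
  have -> : f%:Z ^+ 2 * q%:Z = ((f ^ 2) * q)%N by rewrite PoszM; ring.
  rewrite /coprimez eqz_nat -/(coprime p _) coprimeMr coprimeXr ?prime_coprime //=.
  by rewrite dvdn_prime2 // prime_pair_neq.
by move=> /coprimezP[[u v] /= uv]; exists u, 0, (- v); rewrite -[RHS]uv; ring.
Qed.

Lemma norm_p : qnorm d 0 1 = p%:Z * - q%:Z.
Proof. by rewrite /qnorm /d PoszM; ring. Qed.

Lemma nonprincipal_p (c : algC) : ~~ (p %| f)%N -> ~ form_repr1 ->
  ideal_mul (gen_ideal d f p 0 1) OK <> scale c OK.
Proof.
move=> p_f noA Dc; apply: noA.
have nz_p : p%:Z != 0 by rewrite eqz_nat -lt0n prime_gt0.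
have [[a [b Dab]] _] :=
  gen_extend_principal d_mod4 nz_p norm_p (bezout_p p_f) Dc.
by apply: (@qnorm_p_form_repr1 a b); move: Dab; clear; lia.
Qed.

Lemma invertible_p : ~~ (p %| f)%N -> invertible_ideal (O f) (gen_ideal d f p 0 1).
Proof.
move=> p_f; apply: (gen_invertible _ norm_p (bezout_p p_f)).
by rewrite eqz_nat -lt0n prime_gt0.
Qed.

(** As d = 3 mod 4, the norm 1 - d of 1 + sqrt d is twice an odd number. So 1 + sqrt d generates the
    prime above 2 times an ideal of odd norm, and one of the two factors is prime to any given prime
    conductor. *)
Lemma half_norm : exists m : int, qnorm d 1 1 = 2 * m /\ exists k, m = 2 * k + 1.
Proof.
exists (- (2 * (d %/ 4)%N%:Z + 1)); split; last by exists (- (d %/ 4)%N%:Z - 1); ring.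
by rewrite /qnorm {1}(divn_eq d 4) d_mod4 PoszD PoszM; ring.
Qed.

Lemma bezout_2 (m : int) : odd f -> (exists k, m = 2 * k + 1) ->
  exists u v e : int,
    u * 2 + v * (f%:Z * (2 * 1)) + e * (f%:Z ^+ 2 * m) = 1.
Proof.
move=> f_odd [k Dm]; have Df : f%:Z = 2 * (f./2)%:Z + 1 by lia.
exists (- (m * (2 * (f./2)%:Z * (f./2)%:Z + 2 * (f./2)%:Z) + k)), 0, 1.
by rewrite Dm Df; ring.
Qed.

End Nonprincipal.

(** * Picard groups of orders and the coefficients of the fundamental unit *)

Section FundamentalUnit.

Variables (eps : algC) (x y : nat).
Hypothesis eps_gt1 : 1 < eps.
Hypothesis unitsE : ring_units OK = [set u | exists k : int, u = eps ^ k \/ u = - eps ^ k].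
Hypothesis epsE : eps = qi x y.

Lemma eps_neq0 : eps != 0.
Proof. by rewrite gt_eqF // (lt_trans ltr01). Qed.

(** The norm is 1 or -1, and x^2 - d y^2 is congruent to x^2 + y^2 mod 4, which is never -1. *)
Lemma qnorm_eps : qnorm d x y = 1.
Proof.
have [_ [v [/OKP[a [b ->]] /eqP]]] := eps_unit unitsE 1; rewrite expr1z epsE => /eqP uv.
have : qnorm d x y * qnorm d a b = 1.
  by rewrite -[RHS](qnorm_int d 1); apply: (qnorm_mul d_mod4); rewrite uv qi_int.
move=> N1; have : (qnorm d x y %| 1)%Z by apply/dvdzP; exists (qnorm d a b); rewrite mulrC.
rewrite dvdz1 => /eqP absN.
suff : qnorm d x y != -1 by move: absN; clear; lia.
apply/eqP; rewrite /qnorm (divn_eq d 4) d_mod4 PoszD PoszM.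
by case: (sqrz_mod8 x) => [[k [h [_ ->]]]|[k [_ ->]]];
  case: (sqrz_mod8 y) => [[l [i [_ ->]]]|[l [_ ->]]]; clear; lia.
Qed.

Lemma eps_pell : (x ^ 2 = d * y ^ 2 + 1)%N.
Proof. by have := qnorm_eps; rewrite /qnorm; move: (d) => d'; clear; lia. Qed.

Lemma epsV : eps^-1 = qi x (- y%:Z).
Proof.
apply: (mulfI eps_neq0); rewrite mulfV ?eps_neq0 // {1}epsE.
by rewrite qi_conj qnorm_eps.
Qed.

Lemma eps_pow_ind (Q : set algC) : Q 1 ->
    (forall z, Q z -> Q (eps * z)) -> (forall z, Q z -> Q (eps^-1 * z)) ->
  forall k : int, Q (eps ^ k).
Proof.
move=> Q1 QM QV [] n; rewrite ?NegzE -?exprnN -?exprnP.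
  by elim: n => // n IHn; rewrite exprS; apply: QM.
rewrite -exprVn; move: n.+1 => {}n.
by elim: n => [|n IHn]; rewrite ?expr0 // exprS; apply: QV.
Qed.

Lemma qnorm_eps_pow (k : int) a b : eps ^ k = qi a b -> qnorm d a b = 1.
Proof.
have : [set z | exists a b, z = qi a b /\ qnorm d a b = 1] (eps ^ k).
  apply: eps_pow_ind => [|_ [c [e [-> N1]]]|_ [c [e [-> N1]]]] /=.
  - by exists 1, 0; rewrite qi_int qnorm_int.
  - rewrite epsE qiM; do 2!eexists; split; first by [].
    by rewrite qnormM N1 qnorm_eps.
  rewrite epsV qiM; do 2!eexists; split; first by [].
  by rewrite qnormM N1 mulr1 -qnorm_eps /qnorm; ring.
by move=> [c [e [-> N1]]] /(qi_inj d_mod4)[<- <-].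
Qed.

Lemma eps_pow_zorder f (k : int) : (f %| y)%N -> O f (eps ^ k).
Proof.
move=> /dvdnP[y' Dy]; have ringO := zorder_subring d f.
apply: eps_pow_ind => [|z Oz|z Oz]; first exact: (ring1 ringO).
  apply: (ringM ringO) => //; rewrite epsE; exists x, y'.
  by rewrite Dy PoszM mulrC.
apply: (ringM ringO) => //; rewrite epsV; exists x, (- y'%:Z).
by rewrite Dy PoszM; congr qi; ring.
Qed.

(** In the other case of [pell_even], eps is the square of a unit, hence of a power eps^k up to
    sign; then eps^(2k-1) = 1, impossible for eps > 1 and an odd exponent. *)
Lemma y_even_form_repr1 : ~~ odd y -> form_repr1.
Proof.
case/(pell_even p_prime q_prime p_mod4 q_mod4 eps_pell) => [|[a [b Dab]]]; last first.
  by exists a, b; rewrite Dab.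
case=> a [b [Dab Dx Dy]].
have Deps : eps = qi a b * qi a b.
  by rewrite epsE qiM; congr qi; rewrite ?Dx ?Dy /d; lia.
have [k Dk] : exists k : int, qi a b = eps ^ k \/ qi a b = - eps ^ k.
  have : ring_units OK (qi a b).
    split; first exact: OK_qi.
    exists (qi a (- b%:Z)); split; first exact: OK_qi.
    rewrite qi_conj (_ : qnorm d a b = 1) // /qnorm.
    by move: Dab; rewrite -/d; move: (d) => e; clear; lia.
  by rewrite unitsE.
have pow_neq1 (n : nat) : n != 0%N -> eps ^+ n != 1.
  by move=> nz_n; rewrite gt_eqF // exprn_egt1.
have eps1 : eps ^ (2 * k - 1) = 1.
  rewrite exprzDr ?unitfE ?eps_neq0 // mulrC -exprz_exp.
  have -> : (eps ^ 2) ^ k = eps.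
    rewrite exprz_exp mulrC -exprz_exp -exprnP {2}Deps expr2.
    by case: Dk => ->; rewrite ?mulrNN.
  by rewrite mulVf ?eps_neq0.
have [n [nz_n [Dn|Dn]]] : exists n : nat, n != 0%N /\
    (2 * k - 1 = n%:Z \/ 2 * k - 1 = - n%:Z).
  by exists (absz (2 * k - 1)%R); split; clear; lia.
- by move: eps1; rewrite Dn -exprnP => /eqP; rewrite (negPf (pow_neq1 n nz_n)).
move: eps1; rewrite Dn -exprnN => /eqP.
by rewrite invr_eq1 (negPf (pow_neq1 n nz_n)).
Qed.

Lemma y_odd_repr2 : odd y -> norm_repr2 \/ form_repr2.
Proof. by apply: pell_odd => //; exact: eps_pell. Qed.

Lemma ker_unit (f : nat) a b : coprimez (qnorm d a b) f ->
  exists u t, [/\ OK u, OK t & qi a b * u = 1 + f%:R * t].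
Proof.
move=> /coprimezP[[m n] /= mn].
exists (m%:~R * qi a (- b)), (- n%:~R); split.
- by apply: (ringM ringK); [exact: (ring_int ringK) | exact: OK_qi].
- by apply: (ringN ringK); exact: (ring_int ringK).
transitivity ((m * qnorm d a b + n * f%:Z)%:~R - n%:~R * (Posz f)%:~R : algC).
  by rewrite mulrCA qi_conj -!intrM -intrB addrK.
by rewrite mn -[(Posz f)%:~R]/(f%:R); ring.
Qed.

Lemma ker_qi_invertible (f : nat) a b : (0 < f)%N -> coprimez (qnorm d a b) f ->
  invertible_ideal (O f) (ker_ideal d f (qi a b)).
Proof.
move=> f_gt0 /ker_unit[u [t [Ou Ot uE]]].
exact: (ker_invertible f_gt0 (OK_qi d a b) Ou Ot uE).
Qed.

Lemma ker_qi_equiv (f : nat) a b c e : (0 < f)%N ->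
    coprimez (qnorm d a b) f -> coprimez (qnorm d c e) f ->
    ideal_equiv (O f) (ker_ideal d f (qi a b)) (ker_ideal d f (qi c e)) ->
  exists (k n s1 s2 g h : int), [/\ eps ^ k = qi g h,
    a = n * (g * c + d%:Z * h * e) + f%:Z * s1
    & b = n * (g * e + h * c) + f%:Z * s2].
Proof.
move=> f_gt0 /ker_unit[u [t [Ou Ot uE]]] /ker_unit[u' [t' [Ou' Ot' uE']]] eqv.
have [k [n [_ [/OKP[s1 [s2 ->]]]]]] := ker_equiv unitsE f_gt0
  (OK_qi d a b) Ou Ot uE (OK_qi d c e) Ou' Ot' uE' eqv.
have [/OKP[g [h Dk]] _] := eps_unit unitsE k.
rewrite Dk mulrCA qiM -(qi_int d) -[f%:R]/((Posz f)%:~R) -(qi_int d f) !qiM qiD.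
move=> /(qi_inj d_mod4)[-> ->]; exists k, n, s1, s2, g, h.
by split=> //; ring.
Qed.

(** Kernel ideals become trivial in O_K, the other ideal does not. *)
Lemma ker_gen_nonequiv (f : nat) n r t a b : (0 < f)%N -> coprimez (qnorm d a b) f ->
    (forall c, ideal_mul (gen_ideal d f n r t) OK <> scale c OK) ->
  ~ ideal_equiv (O f) (gen_ideal d f n r t) (ker_ideal d f (qi a b)).
Proof.
move=> f_gt0 /ker_unit[u [v [Ou Ov uE]]] nonprinc [c [_ _ Dc]]; apply: (nonprinc c).
by rewrite Dc ideal_mul_scale (ker_extend (OK_qi d a b) Ou Ov uE).
Qed.

(** If y is even, all powers of eps lie in O_2, so the units 1 and sqrt d modulo 2 give two kernel
    classes; an ideal of odd norm m, whose product with the prime above 2 is principal, gives a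
    third class. *)
Lemma card_Pic2_odd : ~ norm_repr2 -> card_Pic (O 2) = 2%N -> odd y.
Proof.
move=> noB h2; apply: contrapT => /negP y_even.
have [m [Dm [k0 m_odd]]] := half_norm.
have nz_m : m != 0 by move: m_odd; clear; lia.
have norm_m : qnorm d 1 1 = m * 2 by rewrite Dm mulrC.
have bez : exists u v e : int,
    u * m + v * (2%:Z * (2 * 1)) + e * (2%:Z ^+ 2 * 2) = 1.
  (* An odd square is 1 mod 4: m^2 - 4 k0 (k0 + 1) = 1. *)
  by exists m, (- (k0 * (k0 + 1))), 0; rewrite m_odd; ring.
have nonprinc c : ideal_mul (gen_ideal d 2 m 1 1) OK <> scale c OK.
  by move=> /(gen_extend_principal d_mod4 nz_m norm_m bez)[_ [a [b Dab]]];
     apply: noB; exists a, b.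
have invG := gen_invertible nz_m norm_m bez.
have cop1 : coprimez (qnorm d 1 0) 2 by rewrite qnorm_int.
have cop2 : coprimez (qnorm d 0 1) 2.
  rewrite (_ : qnorm d 0 1 = - d%:Z); last by rewrite /qnorm; ring.
  rewrite /coprimez gcdNz eqz_nat -/(coprime d 2) coprimen2.
  by move: d_mod4; clear; lia.
have two_gt0 : (0 < 2)%N by [].
have [] := card_Pic_le2 (zorder_subring d 2) h2 invG
  (ker_qi_invertible two_gt0 cop1) (ker_qi_invertible two_gt0 cop2).
- exact: ker_gen_nonequiv two_gt0 cop1 nonprinc.
- exact: ker_gen_nonequiv two_gt0 cop2 nonprinc.
move=> /(ideal_equiv_sym)/(ker_qi_equiv two_gt0 cop2 cop1).
move=> [k [n [s1 [s2 [g [h [Dk _ Dh]]]]]]].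
have := eps_pow_zorder (f := 2) k; rewrite dvdn2 => /(_ y_even)[g' [h']].
rewrite Dk => /(qi_inj d_mod4)[_ Dh']; move: Dh; rewrite Dh'; clear; lia.
Qed.

(** Modulo l the square of sqrt d is 0, so eps^k is x^k + k x^(k-1) y sqrt d. As y is invertible, k
    can be chosen to reach any ratio of coordinates, and an integer factor does the rest. *)
Lemma card_Pic_ramified (l : nat) : prime l -> (l %| d)%N -> ~~ (l %| y)%N ->
    card_Pic OK = 2%N -> ~ norm_repr2 -> card_Pic (O l) = 2%N.
Proof.
move=> l_prime l_d l_y h2 noB.
have l_odd : odd l.
  by move: l_d d_mod4; case: (even_prime l_prime) => [->|//]; clear; lia.
have [m [Dm m_odd]] := half_norm.
have bez := bezout_2 l_odd m_odd.
pose P : set algC := [set z | exists a b, z = qi a b /\ (l %| a)%Z].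
have PE a b : P (qi a b) <-> (l %| a)%Z.
  by split=> [[c [e [/(qi_inj d_mod4)[-> _]]]] | la] //; exists a, b.
have ld : (l %| d%:Z)%Z by [].
apply: (@card_Pic_prime d d_mod4 eps unitsE l P _ _ _ _ _ _ 2 1 1 m) => //.
- by exists 0, 0; rewrite qi_int dvdz0.
- move=> _ _ [a [b [-> la]]] [c [e [-> lc]]]; rewrite qiD; apply/PE.
  exact: rpredD.
- move=> _ _ [a [b [-> la]]] /OKP[c [e ->]]; rewrite qiM; apply/PE.
  by rewrite rpredD // -?mulrA dvdz_mulr.
- rewrite -[1]/(1%:~R) -(qi_int d) => /PE; rewrite dvdzE /= dvdn1 => /eqP l1.
  by move: l_prime; rewrite l1.
- move=> _ /OKP[a [b ->]] /PE/negP l_a.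
  have dF : d%:R = 0 :> 'F_l.
    by apply/eqP; rewrite -(dvdz_Fp l_prime d).
  have aF : a%:~R != 0 :> 'F_l by rewrite -dvdz_Fp.
  have yF : y%:R != 0 :> 'F_l by rewrite -(dvdz_Fp l_prime y).
  have x2 : x%:R ^+ 2 = 1 :> 'F_l.
    have := congr1 (fun n : nat => n%:R : 'F_l) eps_pell.
    by rewrite natrX natrD natrM dF mul0r add0r.
  have xF : x%:R != 0 :> 'F_l.
    by apply/eqP => x0; move/eqP: x2; rewrite x0 expr0n eq_sym oner_eq0.
  (* The second coordinate is multiplied by x to avoid the exponent k - 1. *)
  have powE (k : nat) : exists g h, [/\ eps ^+ k = qi g h,
      g%:~R = x%:R ^+ k :> 'F_l & x%:R * h%:~R = k%:R * x%:R ^+ k * y%:R :> 'F_l].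
    elim: k => [|k [g [h [Dk Dg Dh]]]].
      by exists 1, 0; rewrite qi_int mulr0 !mul0r.
    rewrite exprS Dk epsE qiM; do 2!eexists; split; first by [].
      rewrite !(intrD, intrM) -[(Posz x)%:~R]/(x%:R) -[(Posz d)%:~R]/(d%:R) dF Dg.
      by rewrite exprS; ring.
    rewrite !(intrD, intrM) -[(Posz x)%:~R]/(x%:R) -[(Posz y)%:~R]/(y%:R).
    transitivity (x%:R * (x%:R * h%:~R) + x%:R * y%:R * g%:~R : 'F_l).
      by ring.
    by rewrite Dh Dg -natr1 exprS; ring.
  (* The solution of k y / x = b / a. *)
  have [k Dk] : exists k : nat, k%:R = b%:~R * x%:R / (a%:~R * y%:R) :> 'F_l.
    by eexists; apply: natr_Zp.
  have [n Dn] := Fp_int (x%:R ^+ k / a%:~R : 'F_l).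
  have [g [h [Dgh Dg Dh]]] := powE k.
  have /dvdzP[v1 Dv1] : (l %| g - n * a)%Z.
    by rewrite (dvdz_Fp l_prime) intrB intrM -Dn Dg divfK // subrr.
  have /dvdzP[v2 Dv2] : (l %| h - n * b)%Z.
    rewrite (dvdz_Fp l_prime) intrB intrM -Dn; apply/eqP; apply: (mulfI xF).
    rewrite mulr0 mulrBr Dh Dk; field; apply/andP.
    by split.
  exists k, n, (qi v1 v2); split; first exact: OK_qi.
  rewrite -exprnP Dgh -(qi_int d) -[l%:R]/((Posz l)%:~R) -(qi_int d l) !qiM qiD.
  by congr qi; [rewrite -[LHS](subrK (n * a)) Dv1 | rewrite -[LHS](subrK (n * b)) Dv2];
    ring.
have nz_2 : 2 != 0 :> int by [].
move=> c /(gen_extend_principal d_mod4 nz_2 Dm bez)[[a [b Dab]] _].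
by apply: noB; exists a, b.
Qed.

(** The units of O_K modulo 2 are 1 and sqrt d; as y is odd and x even, they are eps^0 and eps^1.
    The nonprincipal ideal is the one above p, which is prime to 2. *)
Lemma card_Pic_two : odd y -> card_Pic OK = 2%N -> ~ form_repr1 -> card_Pic (O 2) = 2%N.
Proof.
move=> y_odd h2 noA.
have p_2 : ~~ (p %| 2)%N.
  by rewrite dvdn_prime2 //; apply: contra_eqN p_mod4 => /eqP->.
have x_even : ~~ odd x.
  have := congr1 odd eps_pell; rewrite addn1 /= !(oddX, oddM) y_odd.
  by rewrite orbT andbT /=; move: d_mod4; clear; lia.
pose P : set algC := [set z | exists a b k, z = qi a b /\ a + b = 2 * k].
have PE a b : P (qi a b) <-> exists k, a + b = 2 * k.
  by split=> [[c [e [k [/(qi_inj d_mod4)[-> ->]]]]] | [k Dk]];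
    [exists k | exists a, b, k].
pose h := (d %/ 2)%N; have Dd : d = (2 * h + 1)%N.
  by rewrite /h; move: d_mod4; clear; lia.
apply: (@card_Pic_prime d d_mod4 eps unitsE 2 P _ _ _ _ _ _ p 0 1 (- q%:Z)) => //.
- by exists 0, 0, 0; rewrite qi_int.
- move=> _ _ [a [b [k [-> Dk]]]] [c [e [m [-> Dm]]]]; rewrite qiD; apply/PE.
  by exists (k + m); move: Dk Dm; clear; lia.
- move=> _ _ [a [b [k [-> Dk]]]] /OKP[c [e ->]]; rewrite qiM; apply/PE.
  exists (k * c + k * e + h%:Z * b * e); rewrite Dd PoszD PoszM.
  have -> : a = 2 * k - b by rewrite -Dk addrK.
  ring.
- rewrite -[1]/(1%:~R) -(qi_int d) => /PE[k]; clear; lia.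
- move=> _ /OKP[a [b ->]] nP.
  have ab_odd : exists k, a + b = 2 * k + 1.
    exists ((a + b) %/ 2)%Z; apply: contrapT => ab_even; apply: nP; apply/PE.
    by exists ((a + b) %/ 2)%Z; move: ab_even; clear; lia.
  have [s Ds] : exists s, b = 2 * s \/ b = 2 * s + 1.
    by exists (b %/ 2)%Z; clear; lia.
  have [k Dk] := ab_odd; case: Ds => Db.
    exists 0, 1, (qi (s - k) (- s)); split; first exact: OK_qi.
    rewrite expr0z -[2%:R]/(2%:~R) -[1 in LHS]/(1%:~R) -!(qi_int d) !qiM qiD.
    by congr qi; move: Dk Db; clear; lia.
  exists 1, 1, (qi ((x./2)%:Z - (k - s)) ((y./2)%:Z - s)); split; first exact: OK_qi.
  rewrite expr1z epsE -[2%:R]/(2%:~R) -!(qi_int d) !qiM qiD.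
  by congr qi; move: Dk Db x_even y_odd; clear; lia.
- by rewrite eqz_nat -lt0n prime_gt0.
- exact: norm_p.
- exact: bezout_p.
by move=> c; apply: nonprincipal_p.
Qed.

(** As l divides y, all powers of eps lie in O_l, so the kernel classes of 1 + c g sqrt d are
    separated by c mod l. The values 0, 1, 2 are distinct there, and the norms are prime to l g
    because l divides d. *)
Lemma card_Pic_ramified_neq2 (l g : nat) : prime l -> odd l -> (l %| d)%N ->
  (l %| y)%N -> ~~ (l %| g)%N -> (0 < g)%N -> card_Pic (O (l * g)) <> 2%N.
Proof.
move=> l_prime l_odd l_d l_y l_g g_gt0 h2.
have l_gt2 : (2 < l)%N by rewrite odd_prime_gt2.
have f_gt0 : (0 < l * g)%N by rewrite muln_gt0 prime_gt0.
have cop (c : int) : coprimez (qnorm d 1 (c * g%:Z)) (l * g)%N.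
  apply/coprimezP; have [d' Dd] := dvdnP l_d.
  exists (1, c ^+ 2 * g%:Z * d'%:Z) => /=.
  by rewrite /qnorm Dd !PoszM; ring.
have inv (c : int) := ker_qi_invertible f_gt0 (cop c).
have neq (c c' : int) : ideal_equiv (O (l * g)) (ker_ideal d (l * g) (qi 1 (c * g%:Z)))
    (ker_ideal d (l * g) (qi 1 (c' * g%:Z))) -> (l %| c - c')%Z.
  move=> /(ker_qi_equiv f_gt0 (cop c) (cop c')).
  move=> [k [n [s1 [s2 [u [v [Dk D1 D2]]]]]]].
  have := eps_pow_zorder k l_y; rewrite Dk => -[u' [v' /(qi_inj d_mod4)[_ Dv]]].
  have : (l %| (c - c') * g%:Z)%Z.
    rewrite PoszM Dv in D1 D2.
    have -> : (c - c') * g%:Z = c * g%:Z - c' * g%:Z *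
        (n * (u * 1 + d%:Z * (l%:Z * v') * (c' * g%:Z)) + l%:Z * g%:Z * s1).
      by rewrite -D1; ring.
    apply/dvdzP; rewrite D2.
    exists (n * v' + g%:Z * s2 - c' * g%:Z * (n * d%:Z * v' * (c' * g%:Z) + g%:Z * s1)).
    by ring.
  by rewrite Euclid_dvdzM // => /orP[//|]; rewrite dvdzE /= (negPf l_g).
have small (c : int) : c = 1 \/ c = 2 \/ c = -1 -> ~ (l %| c)%Z.
  move=> Dc; rewrite dvdzE; have [Dn|Dn] : `|c|%N = 1%N \/ `|c|%N = 2%N.
  - by move: Dc; clear; lia.
  - by rewrite Dn gtnNdvd // ltnW.
  by rewrite Dn gtnNdvd.
have [] := card_Pic_le2 (zorder_subring d (l * g)) h2 (inv 0) (inv 1) (inv 2).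
- by move=> /neq; apply: small; right; right.
- by move=> /neq; rewrite sub0r rpredN; apply: small; right; left.
by move=> /neq; apply: small; right; right.
Qed.

(** An integer times a power of eps has square norm, so an element whose norm is a nonresidue mod l
    gives a nontrivial kernel class; the trivial class and that of the ideal above p are two
    more. *)
Lemma card_Pic_unramified_neq2 (l g : nat) : prime l -> odd l -> ~~ (l %| d)%N ->
    ~~ (l %| g)%N -> (0 < g)%N -> ~~ (p %| l * g)%N -> ~ form_repr1 ->
  card_Pic (O (l * g)) <> 2%N.
Proof.
move=> l_prime l_odd l_d l_g g_gt0 p_f noA h2.
have f_gt0 : (0 < l * g)%N by rewrite muln_gt0 prime_gt0.
have [r r_nonres] := exists_nonresidue_norm l_prime l_odd (l_d : ~~ (l %| d%:Z)%Z).
have : coprimez l g by rewrite /coprimez eqz_nat -/(coprime l g) prime_coprime.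
move=> /coprimezP[[v u] /= uv].
(* Chinese remainders: a + b sqrt d is r + sqrt d modulo l and 1 modulo g. *)
pose b := u * g%:Z; pose a := 1 + b * (r - 1).
have Db : b = 1 - v * l%:Z by rewrite /b -uv; ring.
have Dnorm : exists t, qnorm d a b = r ^+ 2 - d%:Z + l%:Z * t.
  exists (- v * (r - 1) * (2 * r - v * l%:Z * (r - 1)) + d%:Z * v * (2 - v * l%:Z)).
  by rewrite /qnorm /a Db; ring.
have Dnorm1 : exists t, qnorm d a b = 1 + g%:Z * t.
  exists (2 * u * (r - 1) + u * b * (r - 1) ^+ 2 - d%:Z * u * b).
  by rewrite /qnorm /a /b; ring.
have cop : coprimez (qnorm d a b) (l * g)%N.
  rewrite PoszM coprimezMr; apply/andP; split.
    rewrite coprimez_sym /coprimez eqz_nat -/(coprime l _) prime_coprime //.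
    apply/negP => l_N; have /negP[] := r_nonres 0.
    have [t Dt] := Dnorm; rewrite expr0n sub0r rpredN.
    have -> : r ^+ 2 - d%:Z = qnorm d a b - l%:Z * t by rewrite Dt addrK.
    by rewrite rpredB ?dvdz_mulr.
  have [t ->] := Dnorm1; apply/coprimezP; exists (1, - t) => /=; ring.
have cop1 : coprimez (qnorm d 1 0) (l * g)%N.
  by apply/coprimezP; exists (1, 0); rewrite qnorm_int.
have nonprinc c := nonprincipal_p (c := c) p_f noA.
have [] := card_Pic_le2 (zorder_subring d (l * g)) h2 (invertible_p p_f)
  (ker_qi_invertible f_gt0 cop) (ker_qi_invertible f_gt0 cop1).
- exact: ker_gen_nonequiv f_gt0 cop nonprinc.
- exact: ker_gen_nonequiv f_gt0 cop1 nonprinc.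
move=> /(ker_qi_equiv f_gt0 cop cop1).
move=> [k [n [s1 [s2 [g' [h [Dk Da Dh]]]]]]].
have Nk := qnorm_eps_pow Dk; have /negP[] := r_nonres n.
have [t Dt] := Dnorm.
have -> : n ^+ 2 - (r ^+ 2 - d%:Z) = n ^+ 2 * qnorm d g' h - qnorm d a b + l%:Z * t.
  by rewrite Dt Nk; ring.
rewrite Da Dh; apply/dvdzP.
exists (t - (2 * n * g' * g%:Z * s1 + (l * g)%N%:Z * g%:Z * s1 ^+ 2)
          + d%:Z * (2 * n * h * g%:Z * s2 + (l * g)%N%:Z * g%:Z * s2 ^+ 2)).
by rewrite /qnorm PoszM; ring.
Qed.

End FundamentalUnit.

(** The sign s is chosen to make s p a square mod q. Modulo p either sign works: q b^2 is 2 or -2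
    there, and both 2 and -1 are squares. *)
Lemma form_repr2_residues : (p %% 8 = 1)%N -> form_repr2 -> exists s c e : int,
  [/\ s ^+ 2 = 1, (p %| c ^+ 2 + s * q%:Z)%Z & (q %| e ^+ 2 - s * p%:Z)%Z].
Proof.
move=> p_mod8 [a [b Dab]].
have q_p : ~~ (q %| p%:Z)%Z.
  by rewrite dvdzE /= dvdn_prime2 // eq_sym prime_pair_neq.
have [e [s [s2 q_e]]] := residue_up_to_sign q_prime q_mod4 q_p.
have [a0 [b0 []]] := residue2_mod8 p_prime p_mod8.
rewrite !(dvdz_Fp p_prime) => /eqP a0E /eqP b0E.
have pF : (Posz p)%:~R = 0 :> 'F_p by apply/eqP; rewrite -(dvdz_Fp p_prime) dvdzz.
have [t [t2 Dt]] : exists t : int, t ^+ 2 = 1 /\ q%:Z * b ^+ 2 = p%:Z * a ^+ 2 - 2 * t.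
  have [D|D] : p%:Z * a ^+ 2 - q%:Z * b ^+ 2 = 2 \/ p%:Z * a ^+ 2 - q%:Z * b ^+ 2 = -2.
  - by move: Dab; clear; lia.
  - by exists 1; split=> //; move: D; clear; lia.
  by exists (-1); split=> //; move: D; clear; lia.
have qF : (Posz q)%:~R * b%:~R ^+ 2 = - (a0%:~R ^+ 2 * t%:~R) :> 'F_p.
  move: a0E; rewrite intrB rmorphXn => /eqP; rewrite subr_eq0 => /eqP a0E.
  have := congr1 (fun z : int => z%:~R : 'F_p) Dt.
  by rewrite intrB !intrM pF mul0r sub0r -a0E expr2.
have bF : b%:~R != 0 :> 'F_p.
  apply/eqP => b_0; move: qF; rewrite b_0 expr0n mulr0 => /eqP.
  rewrite eq_sym oppr_eq0 mulf_eq0; apply/negP; rewrite negb_or; apply/andP; split.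
    apply/eqP => a0_0; move: a0E; rewrite intrB rmorphXn /= a0_0 sub0r => /eqP.
    rewrite oppr_eq0 -(dvdz_Fp p_prime) dvdzE gtnNdvd //=.
    by move: p_mod8 (prime_gt1 p_prime); clear; lia.
  apply/eqP => t0; move/eqP: (congr1 (fun z : int => z%:~R : 'F_p) t2).
  by rewrite rmorphXn /= t0 expr0n eq_sym oner_eq0.
have st : s * t = 1 \/ s * t = -1.
  by apply/pred2P; rewrite -sqrf_eq1 exprMn s2 t2.
have stF : (s * t)%:~R = 1 :> 'F_p \/ (s * t)%:~R = b0%:~R ^+ 2 :> 'F_p.
  case: st => ->; [by left | right].
  move: b0E; rewrite intrD rmorphXn /= => /eqP; rewrite addr_eq0 => /eqP->.
  by rewrite rmorphN.
have [c Dc] : exists c : int, c%:~R ^+ 2 * b%:~R ^+ 2 = a0%:~R ^+ 2 * (s * t)%:~R :> 'F_p.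
  case: stF => ->.
    have [c Dc] := Fp_int (a0%:~R / b%:~R : 'F_p).
    by exists c; rewrite -Dc; field.
  have [c Dc] := Fp_int (a0%:~R * b0%:~R / b%:~R : 'F_p).
  by exists c; rewrite -Dc; field.
exists s, c, e; split=> //; rewrite (dvdz_Fp p_prime).
have b2F : b%:~R ^+ 2 != 0 :> 'F_p by rewrite sqrf_eq0.
apply/eqP; apply: (mulIf b2F); rewrite mul0r intrD (rmorphM _ s) rmorphXn /= mulrDl Dc.
by rewrite -(mulrA s%:~R) qF intrM; ring.
Qed.

(** A common prime factor of Z with 2, p or X would, by the equation, also divide both X and Y, or
    have its square divide q. The coprimality makes (Z, p X + Y sqrt d) times its conjugate equal to
    (Z). *)
Lemma legendre_coprime (s X Y Z : int) : s ^+ 2 = 1 -> coprimez X Y ->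
  s * (p%:Z * X ^+ 2 - q%:Z * Y ^+ 2) = Z ^+ 2 -> coprimez Z (2 * (p%:Z * X)).
Proof.
move=> s2 coXY DZ.
have DZ' : p%:Z * X ^+ 2 - q%:Z * Y ^+ 2 = s * Z ^+ 2.
  by rewrite -DZ mulrA -expr2 s2 mul1r.
have co_prime (l : nat) (a b : int) :
    prime l -> (l %| a)%Z -> (l %| b)%Z -> ~~ coprimez a b.
  move=> l_prime la lb; apply/negP => /coprimezP[[u v] /= uv].
  have : (l %| u * a + v * b)%Z by rewrite rpredD ?dvdz_mull.
  by rewrite uv dvdzE /= dvdn1 => /eqP l1; move: l_prime; rewrite l1.
rewrite !coprimezMr; apply/and3P; split.
- rewrite coprimez_sym /coprimez eqz_nat -/(coprime 2 _) prime_coprime //.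
  apply/negP => Z_even; have Z2 : exists z, Z = 2 * z.
    by exists (Z %/ 2)%Z; move: Z_even; clear; lia.
  have [z Dz] := Z2; rewrite Dz in DZ'.
  have [[P Dp] [Q Dq]] :
      (exists P : int, p%:Z = 4 * P + 1) /\ (exists Q : int, q%:Z = 4 * Q + 3).
    split; [exists (p %/ 4)%N | exists (q %/ 4)%N]; first by move: p_mod4; clear; lia.
    by move: q_mod4; clear; lia.
  rewrite Dp Dq (_ : s * (2 * z) ^+ 2 = 4 * (s * z ^+ 2)) in DZ'; last by ring.
  case: (sqrz_mod8 X) => [[k [h [_ D1]]]|[k [DX D1]]];
    case: (sqrz_mod8 Y) => [[m [i [_ D2]]]|[m [DY D2]]];
    rewrite D1 D2 in DZ'; try by move: DZ'; clear; lia.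
  by have/negP[] : ~~ coprimez X Y by apply: (@co_prime 2) => //; rewrite ?DX ?DY dvdz_mulr.
- rewrite coprimez_sym /coprimez eqz_nat -/(coprime p _) prime_coprime //.
  apply/negP => p_Z; have {}p_Z : (p %| Z)%Z by [].
  have p_Y : (p %| Y)%Z.
    have : (p %| q%:Z * Y ^+ 2)%Z.
      have -> : q%:Z * Y ^+ 2 = p%:Z * X ^+ 2 - s * Z * Z.
        by rewrite -mulrA -expr2 -DZ'; ring.
      by apply: rpredB; [exact: dvdz_mulr | exact: dvdz_mull].
    rewrite Euclid_dvdzM // Euclid_dvdzX // dvdzE /= dvdn_prime2 //.
    by rewrite (negPf prime_pair_neq).
  have p_X : (p %| X)%Z.
    have [z Dz] := dvdzP p_Z; have [y' Dy] := dvdzP p_Y.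
    have nz_p : p%:Z != 0 by rewrite eqz_nat -lt0n prime_gt0.
    rewrite -(@Euclid_dvdzX _ _ 1) //; apply/dvdzP.
    exists (q%:Z * y' ^+ 2 + s * z ^+ 2); apply: (mulfI nz_p).
    have -> : p%:Z * X ^+ 2 = q%:Z * Y ^+ 2 + s * Z ^+ 2 by rewrite -DZ'; ring.
    by rewrite Dz Dy; ring.
  by move/negP: (co_prime _ _ _ p_prime p_X p_Y); apply.
apply/negPn/negP => ncoZX.
have [l l_prime [l_Z l_X]] : exists2 l, prime l & (l %| Z)%Z /\ (l %| X)%Z.
  have g1 : gcdn `|Z| `|X| != 1%N by move: ncoZX; rewrite /coprimez eqz_nat.
  have g0 : (gcdn `|Z| `|X| != 0)%N.
    apply/eqP => g0; move: (dvdn_gcdl `|Z| `|X|) (dvdn_gcdr `|Z| `|X|).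
    rewrite g0 !dvd0n !absz_eq0 => /eqP Z0 /eqP X0; move: DZ'; rewrite Z0 X0.
    rewrite !expr0n !mulr0 sub0r => /eqP; rewrite oppr_eq0 mulf_eq0 sqrf_eq0.
    rewrite eqz_nat (gtn_eqF (prime_gt0 q_prime)) /= => /eqP Y0.
    by move: coXY; rewrite X0 Y0.
  exists (pdiv (gcdn `|Z| `|X|)); first by rewrite pdiv_prime // ltn_neqAle eq_sym g1 lt0n.
  by split; rewrite dvdzE; apply: dvdn_trans (pdiv_dvd _) _; rewrite ?dvdn_gcdl ?dvdn_gcdr.
have l_Y : ~~ (l %| Y)%Z.
  by apply/negP => l_Y; move/negP: (co_prime _ _ _ l_prime l_X l_Y); apply.
have [z Dz] := dvdzP l_Z; have [x' Dx] := dvdzP l_X.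
have : ((l ^ 2)%N %| q%:Z * Y ^+ 2)%Z.
  apply/dvdzP; exists (p%:Z * x' ^+ 2 - s * z ^+ 2).
  have -> : q%:Z * Y ^+ 2 = p%:Z * X ^+ 2 - s * Z ^+ 2 by rewrite -DZ'; ring.
  by rewrite Dz Dx -mulnn PoszM; ring.
rewrite Gauss_dvdzl; last first.
  rewrite /coprimez eqz_nat abszX -/(coprime _ _) coprimeXr // coprimeXl //.
  by rewrite prime_coprime.
rewrite dvdzE /= => l2_q; have : (l %| q)%N by apply: dvdn_trans l2_q; rewrite dvdn_exp.
rewrite dvdn_prime2 // => /eqP Dl; move: l2_q.
by rewrite Dl (negPf (prime_sqr_ndvd q_prime)).
Qed.

Lemma prime_sqr_cofactor (s t m : int) : s ^+ 2 = 1 -> p%:Z * s = t ^+ 2 * m ->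
  m = p%:Z \/ m = - p%:Z.
Proof.
move=> s2 Dps; have Dp : p%:Z = t ^+ 2 * (s * m).
  transitivity (p%:Z * s * s); last by rewrite Dps; ring.
  by rewrite -mulrA -expr2 s2 mulr1.
have t1 : t ^+ 2 = 1.
  have : (`|t| %| p)%N by rewrite -[p]/(`|p%:Z|%N) Dp abszM abszX dvdn_mulr ?dvdn_exp.
  have /primeP[_ p_div] := p_prime.
  move/p_div/pred2P=> [t1|tp].
    by move: (abszX 2 t); rewrite t1 exp1n; have := sqr_ge0 t; clear; lia.
  have : (p ^ 2 %| p)%N.
    by rewrite -{1}tp -abszX -[X in (_ %| X)%N]/(`|p%:Z|%N) Dp abszM dvdn_mulr.
  by rewrite (negPf (prime_sqr_ndvd p_prime)).
rewrite t1 mul1r in Dp; move/eqP: s2; rewrite sqrf_eq1 => /orP[]/eqP s1;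
  by move: Dp; rewrite s1; clear; lia.
Qed.

(* From a zero of s (p X^2 - q Y^2) - Z^2, the ideal J = (Z, alpha) with      *)
(* alpha = p X + Y sqrt d satisfies J^2 P = (alpha), where P = (p, sqrt d);   *)
(* as P is not principal, the class of J has order 4.                         *)
Lemma form_repr2_mod8 : card_Pic OK = 2%N -> ~ form_repr1 -> form_repr2 -> (p %% 8 <> 1)%N.
Proof.
move=> hK noA C p_mod8.
have [s [c0 [e0 [s2 res_p res_q]]]] := form_repr2_residues p_mod8 C.
have [X [Y [Z [DZ nz_Z coXY]]]] :=
  legendre p_prime q_prime prime_pair_neq s2 res_p res_q.
have coZ := legendre_coprime s2 coXY DZ.
have norm_Z : qnorm d (p%:Z * X) Y = Z * (p%:Z * s * Z).
  transitivity (p%:Z * s * Z ^+ 2); last by ring.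
  rewrite -DZ; transitivity (s ^+ 2 * qnorm d (p%:Z * X) Y); first by rewrite s2 mul1r.
  by rewrite /qnorm /d PoszM; ring.
have [[u v] /= uv] := coprimezP _ _ coZ.
have bez : exists u v e : int, u * Z + v * (1%:Z * (2 * (p%:Z * X)))
    + e * (1%:Z ^+ 2 * (p%:Z * s * Z)) = 1.
  by exists u, v, 0; rewrite -[RHS]uv; ring.
have p_1 : ~~ (p %| 1)%N by rewrite dvdn1 neq_ltn prime_gt1 // orbT.
have nonprinc c' : gen_ideal d 1 p 0 1 <> scale c' OK.
  move=> Dc; apply: (nonprincipal_p (c := c') p_1 noA).
  by rewrite Dc ideal_mul_scale zorder_mul_OK.
pose J := gen_ideal d 1 Z (p%:Z * X) Y.
pose a := qi (p%:Z * X) Y.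
have JZ : J Z%:~R by apply: gen_mem1.
have Ja : J a by rewrite -[a]mul1r; apply: gen_mem2.
have norm_J g h : J (qi g h) -> (Z %| qnorm d g h)%Z.
  move=> Jgh; apply: (gen_extend_norm d_mod4 (f := 1) norm_Z).
  by rewrite -[qi g h]mulr1; apply: ideal_mul_mem => //; apply: (ring1 ringK).
have J_OK z : J z -> OK z by apply: gen_sub.
(* This puts a in J^2: multiply u Z + 2 v p X = 1 by a, and use that 2 p X is the trace of a and p s
   Z^2 its norm. *)
have Da : a = u%:~R * (Z%:~R * a) + v%:~R * (a * a)
    + v%:~R * p%:~R * s%:~R * (Z%:~R * Z%:~R).
  transitivity ((u * Z + v * (2 * (p%:Z * X)))%:~R * a); first by rewrite uv mul1r.
  have -> : v%:~R * p%:~R * s%:~R * (Z%:~R * Z%:~R) =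
     v%:~R * (a * qi (p%:Z * X) (- Y)).
    by rewrite qi_conj norm_Z; ring.
  by rewrite /a /qelt; ring.
have Oint k := ring_int ringK k.
have norm_sqr g1 g2 k1 k2 h1 h2 : qi g1 g2 * qi g1 g2 * qi k1 k2 = qi h1 h2 ->
    qnorm d g1 g2 ^+ 2 * qnorm d k1 k2 = qnorm d h1 h2.
  by rewrite qiM => /(qnorm_mul d_mod4) <-; rewrite qnormM expr2.
have [] := card_Pic_le2 ringK hK (invertible_ideal_ring ringK) (invertible_p p_1)
  (gen_invertible nz_Z norm_Z bez).
- by case/ideal_equiv_sym=> z [_ _ /nonprinc].
- case/ideal_equiv_sym=> g [_ nz_g Dg].
  have Jg : J g by have := scale_mem g (ring1 ringK); rewrite mulr1 -Dg.
  have /OKP[g1 [g2 Dg12]] := J_OK g Jg.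
  have : scale g OK Z%:~R by rewrite -Dg.
  case=> d1 Od1 D1.
  have : scale g OK a by rewrite -Dg.
  case=> d2 Od2 D2.
  have /OKP[k1 [k2 Dk]] : OK (u%:~R * (d1 * d2) + v%:~R * (d2 * d2)
      + v%:~R * p%:~R * s%:~R * (d1 * d1)).
    by do !apply: (ringD ringK); do ![exact: Oint | done | apply: (ringM ringK)].
  have Dak : g * g * qi k1 k2 = a by rewrite Da -D1 -D2 -Dk; ring.
  have /dvdzP[t Dt] : (Z %| qnorm d g1 g2)%Z by apply: norm_J; rewrite -Dg12.
  (* If J = (g), then a = g^2 k. With N(g) = Z t, norms give p s = t^2 N(k), so N(k) is p or -p. *)
  apply: noA; apply: (@qnorm_p_form_repr1 k1 k2).
  apply: (@prime_sqr_cofactor s t) => //.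
  have nz_Z2 : Z ^+ 2 != 0 by rewrite sqrf_eq0.
  apply: (mulfI nz_Z2); transitivity (qnorm d (p%:Z * X) Y); first by rewrite norm_Z; ring.
  by rewrite Dg12 in Dak; rewrite -(norm_sqr _ _ _ _ _ _ Dak) Dt; ring.
case/ideal_equiv_sym=> g [_ nz_g Dg].
have JE z : gen_ideal d 1 p 0 1 z -> J (g * z) by rewrite /J Dg; apply: scale_mem.
have JG := JE _ (gen_mem1 d 1 p 0 1); have JW := JE _ (gen_mem2 d 1 p 0 1).
have /OKP[g1 [g2 DG]] := J_OK _ JG; have /OKP[h1 [h2 DW]] := J_OK _ JW.
have [Dh1 Dh2] : h1 = q%:Z * g2 /\ p%:Z * h2 = g1.
  have : p%:~R * qi h1 h2 = qi 0 1 * qi g1 g2 by rewrite -DG -DW; ring.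
  rewrite -(qi_int d) !qiM => /(qi_inj d_mod4)[D1 D2]; split.
    apply: (mulfI (_ : p%:Z != 0)); first by rewrite eqz_nat -lt0n prime_gt0.
    by move: D1; rewrite /d PoszM mulrA; clear; lia.
  by move: D2; clear; lia.
have nz_p : p%:Z != 0 by rewrite eqz_nat -lt0n prime_gt0.
(* Now J = g P. The factor g may fail to be integral, so p g replaces it; comparing the norms of p g
   and g sqrt d yields the extra factor p. *)
have [t Dt] : exists t, qnorm d g1 g2 = Z * p%:Z * t.
  have /dvdzP[t1 Dt1] : (Z %| qnorm d g1 g2)%Z by apply: norm_J; rewrite -DG.
  have /dvdzP[t2 Dt2] : (Z %| qnorm d h1 h2)%Z by apply: norm_J; rewrite -DW.
  have Dt12 : p%:Z * t2 = - (q%:Z * t1).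
    apply: (mulfI nz_p); apply: (mulfI nz_Z).
    transitivity (p%:Z ^+ 2 * qnorm d h1 h2); first by rewrite Dt2; ring.
    transitivity (- (p%:Z * q%:Z) * qnorm d g1 g2); last by rewrite Dt1; ring.
    by rewrite /qnorm Dh1 -Dh2 /d PoszM; ring.
  have : (p %| q%:Z * t1)%Z by rewrite -rpredN -Dt12 dvdz_mulr.
  rewrite Euclid_dvdzM // dvdzE /= dvdn_prime2 // (negPf prime_pair_neq) /=.
  by case/dvdzP=> t Dt; exists t; rewrite Dt1 Dt; ring.
have : scale g (gen_ideal d 1 p 0 1) Z%:~R by rewrite -Dg.
case=> _ [s1 [t1 [Os1 Ot1 ->]]] D1.
have : scale g (gen_ideal d 1 p 0 1) a by rewrite -Dg.
case=> _ [s2' [t2 [Os2 Ot2 ->]]] D2.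
have ww : qi 0 1 * qi 0 1 = p%:~R * q%:~R.
  by rewrite qiM /d /qelt; ring.
(* As P^2 = (p), a product of two elements of P is p times an integral element, which is [prod]. *)
pose prod b b' c c' : algC := p%:~R * b * b' + qi 0 1 * (b * c' + b' * c) + q%:~R * c * c'.
have Oprod b b' c c' : OK b -> OK b' -> OK c -> OK c' -> OK (prod b b' c c').
  move=> Ob Ob' Oc Oc'.
  by do ![exact: Oint | done | exact: OK_qi | apply: (ringD ringK) | apply: (ringM ringK)].
have prodE b b' c c' : (p%:~R * b + 1%:R * qi 0 1 * c) * (p%:~R * b' + 1%:R * qi 0 1 * c')
    = p%:~R * prod b b' c c'.
  transitivity (p%:~R * (p%:~R * b * b' + qi 0 1 * (b * c' + b' * c))
    + qi 0 1 * qi 0 1 * c * c'); first by ring.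
  by rewrite ww /prod; ring.
have /OKP[k1 [k2 Dk]] : OK (u%:~R * prod s1 s2' t1 t2 + v%:~R * prod s2' s2' t2 t2
      + v%:~R * p%:~R * s%:~R * prod s1 s1 t1 t1).
  by do ![exact: Oprod | exact: Oint | done | apply: (ringD ringK) | apply: (ringM ringK)].
have Dak : qi g1 g2 * qi g1 g2 * qi k1 k2 = qi (p%:Z * (p%:Z * X)) (p%:Z * Y).
  transitivity (p%:~R * a); last by rewrite /a /qelt; ring.
  rewrite Da -D1 -D2 -DG -Dk.
  transitivity (p%:~R * g * g * (u%:~R * (p%:~R * prod s1 s2' t1 t2)
    + v%:~R * (p%:~R * prod s2' s2' t2 t2)
    + v%:~R * p%:~R * s%:~R * (p%:~R * prod s1 s1 t1 t1))); first by ring.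
  by rewrite -!prodE; ring.
apply: noA; apply: (@qnorm_p_form_repr1 k1 k2); apply: (@prime_sqr_cofactor s t) => //.
apply: (mulfI (_ : (Z * p%:Z) ^+ 2 != 0)); first by rewrite sqrf_eq0 mulf_neq0.
transitivity (qnorm d (p%:Z * (p%:Z * X)) (p%:Z * Y)).
  transitivity (p%:Z ^+ 2 * qnorm d (p%:Z * X) Y); last by rewrite /qnorm; ring.
  by rewrite norm_Z; ring.
by rewrite -(norm_sqr _ _ _ _ _ _ Dak) Dt; ring.
Qed.

End PrimePair.

(** * Unusual conductors *)

Lemma kronecker_primeE (a : int) (l : nat) : 0 <= a -> prime l ->
  kronecker a l%:Z = kronecker_prime a l.
Proof.
move=> a_ge0 l_prime; rewrite /kronecker eqz_nat (gtn_eqF (prime_gt0 l_prime)).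
rewrite ltNge a_ge0 /= mul1r.
by rewrite primes_prime // big_seq1 logn_prime // eqxx expr1.
Qed.

Lemma squarefree_factor (f l : nat) : squarefree f -> prime l -> (l %| f)%N ->
  (0 < f)%N -> exists g, [/\ f = (l * g)%N, ~~ (l %| g)%N & (0 < g)%N].
Proof.
move=> sq_f l_prime /dvdnP[g Df] f_gt0; exists g; split; first by rewrite mulnC.
  apply: contra (sq_f l l_prime) => /dvdnP[h Dg].
  by rewrite Df Dg -mulnA mulnn dvdn_mull.
by move: f_gt0; rewrite Df muln_gt0 => /andP[].
Qed.

Lemma prime_unusual_conductor (d l : nat) : prime l -> (l %| disc d)%N ->
    class_number d = 2%N -> card_Pic (quad_order d l) = 2%N ->
    (forall a b : int, `|l%:Z * a ^+ 2 - (disc d %/ l)%N%:Z * b ^+ 2| != 4%:Z) ->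
  unusual_conductor d l.
Proof.
move=> l_prime l_disc hK hl no4.
have ram : ramified_prime d l.
  by split=> //; rewrite kronecker_primeE // /kronecker_prime dvdzE /= l_disc.
split.
- split=> [|r r_prime]; first exact: prime_gt0.
  apply/negP => r2_l; have : (r %| l)%N by apply: dvdn_trans r2_l; rewrite dvdn_exp.
  rewrite dvdn_prime2 // => /eqP Dr; move: r2_l.
  by rewrite Dr (negPf (prime_sqr_ndvd l_prime)).
- by exists l.
- move=> r [r_prime r_split]; apply/negP; rewrite dvdn_prime2 // => /eqP Dr.
  by move: r_split; rewrite Dr ram.2.
- by rewrite hK hl.
by move=> r [r_prime _]; rewrite dvdn_prime2 // => /eqP->.
Qed.

Theorem proposition2p4 (p q d : nat) (eps : algC) (x y : nat)
    (p_prime : prime p) (q_prime : prime q)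
    (p_mod4 : p = 1 %[mod 4]) (q_mod4 : q = 3 %[mod 4])
    (d_def : d = (p * q)%N)
    (h_d : class_number d = 2%N)
    (eps_unit : fundamental_unit d eps)
    (eps_def : eps = x%:R + y%:R * omega d) :
  [<-> unusual_conductors d = [set 2%N];
       [/\ p = 5 %[mod 8], odd y & (d %| y)%N];
       [/\ p = 5 %[mod 8], kronecker p%:Z q%:Z = -1 & (d %| y)%N] ].
Proof.
have d_mod4 : (d %% 4 = 3)%N by rewrite d_def pq_mod4.
have d_rad n : (d %| n ^+ 2)%Z -> (d %| n)%Z by rewrite d_def; apply: pq_radical.
have discE : disc d = (4 * d)%N by rewrite /disc d_mod4.
have neq_pq := prime_pair_neq p_mod4 q_mod4.
have hK : card_Pic (zorder d 1) = 2%N by rewrite -quad_intE.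
have orderE := quad_orderE d_mod4 d_rad.
have epsE : eps = qelt d x y by rewrite eps_def /omega d_mod4.
have [eps_gt1 unitsE] := eps_unit; rewrite quad_intE // in unitsE.
have [p_gt0 q_gt0] : (0 < p)%N /\ (0 < q)%N by rewrite !prime_gt0.
have two_disc : (disc d %/ 2 = 2 * d)%N by rewrite discE -[4%N]/(2 * 2)%N -mulnA mulKn.
have p_disc : (disc d %/ p = 4 * q)%N.
  by rewrite discE d_def mulnCA mulKn.
have q_disc : (disc d %/ q = 4 * p)%N.
  by rewrite discE d_def mulnA mulnK.
(* At the prime 2 the form is 2 (a^2 - d b^2), so its value 4 or -4 means norm 2 or -2. *)
have two_unusual : ~ norm_repr2 p q -> card_Pic (zorder d 2) = 2%N -> unusual_conductor d 2.
  move=> noB h2; apply: prime_unusual_conductor => //; first by rewrite discE dvdn_mulr.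
    by rewrite orderE.
  move=> a b; rewrite two_disc; apply/eqP => Dab; apply: noB; exists a, b.
  by rewrite -d_def /qnorm; move: Dab; rewrite PoszM; clear; lia.
have p_odd : odd p by move: p_mod4; clear; lia.
have q_odd : odd q by move: q_mod4; clear; lia.
have noB5 : p = 5 %[mod 8] -> ~ norm_repr2 p q.
  move=> p_mod8 [a [b Dab]].
  have : (p %| a ^+ 2 - 2)%Z || (p %| a ^+ 2 + 2)%Z.
    have [D|D] : a ^+ 2 - 2 = p%:Z * (q%:Z * b ^+ 2) \/
                 a ^+ 2 + 2 = p%:Z * (q%:Z * b ^+ 2).
    - by move: Dab; rewrite /qnorm PoszM; clear; lia.
    - by rewrite D dvdz_mulr.
    by rewrite orbC D dvdz_mulr.
  by apply/negP; rewrite negb_or nonresidue2 ?nonresidueN2 //; [left | right].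
have step12 : unusual_conductors d = [set 2%N] ->
    [/\ p = 5 %[mod 8], odd y & (d %| y)%N].
  move=> DD; have [_ _ _ [_ h2] no4] : unusual_conductor d 2.
    by rewrite -[unusual_conductor d 2]/(unusual_conductors d 2%N) DD.
  rewrite orderE in h2.
  have noB : ~ norm_repr2 p q.
    move=> [a [b Dab]].
    have ram2 : ramified_prime d 2.
      by split=> //; rewrite kronecker_primeE // /kronecker_prime discE dvdzE /= dvdn_mulr.
    have /eqP[] := no4 2%N ram2 isT a b; rewrite two_disc.
    by move: Dab; rewrite -d_def /qnorm PoszM; clear; lia.
  have y_odd : odd y.
    by subst d; apply: (card_Pic2_odd p_mod4 q_mod4 eps_gt1 unitsE epsE).
  have C : form_repr2 p q.
    by subst d; have [] := y_odd_repr2 p_prime q_prime p_mod4 q_mod4 unitsE epsE y_odd.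
  have noA : ~ form_repr1 p q by move=> A; apply/noB/form_repr_mul.
  have dv_y (l : nat) : prime l -> (l %| d)%N -> odd l ->
     (forall a b : int, `|l%:Z * a ^+ 2 - (disc d %/ l)%N%:Z * b ^+ 2| != 4%:Z) ->
     (l %| y)%N.
    move=> l_prime l_d l_odd no4l; apply: contraT => l_y.
    have hl : card_Pic (zorder d l) = 2%N.
      by subst d; apply: (card_Pic_ramified p_prime q_prime p_mod4 q_mod4 unitsE epsE).
    have : unusual_conductors d l.
      apply: prime_unusual_conductor; rewrite ?orderE //.
      by rewrite discE dvdn_mull.
    by rewrite DD => Dl; move: l_odd; rewrite Dl.
  have p_y : (p %| y)%N.
    apply: dv_y => //; first by rewrite d_def dvdn_mulr.
    move=> a b; rewrite p_disc; apply/eqP => Dab; apply: noA.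
    (* An odd a makes the form odd; an even a lets the equation be divided by 4, giving
       [form_repr1]. *)
    case: (sqrz_mod8 a) => [[k [j [_ D2]]]|[k [Da _]]].
      by move: Dab p_mod4; rewrite D2 PoszM; clear; lia.
    by exists k, b; move: Dab; rewrite Da PoszM; clear; lia.
  have q_y : (q %| y)%N.
    apply: dv_y => //; first by rewrite d_def dvdn_mull.
    move=> a b; rewrite q_disc; apply/eqP => Dab; apply: noA.
    case: (sqrz_mod8 a) => [[k [j [_ D2]]]|[k [Da _]]].
      by move: Dab q_mod4; rewrite D2 PoszM; clear; lia.
    by exists b, k; move: Dab; rewrite Da PoszM; clear; lia.
  split=> //.
    have p_mod8 : (p %% 8 <> 1)%N.
      by subst d; apply: (form_repr2_mod8 p_prime q_prime p_mod4 q_mod4 hK noA C).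
    by move: p_mod8 p_mod4; clear; lia.
  rewrite d_def Gauss_dvd ?p_y //.
  by rewrite prime_coprime // dvdn_prime2.
have kronE : kronecker p%:Z q%:Z =
    if [exists u : 'I_q, (q%:Z %| (u : nat)%:Z ^+ 2 - p%:Z)%Z] then 1 else -1.
  rewrite kronecker_primeE // /kronecker_prime dvdzE /= dvdn_prime2 // eq_sym.
  rewrite (negPf neq_pq); case: eqP => // Dq.
  by move: q_odd; rewrite Dq.
have step23 : [/\ p = 5 %[mod 8], odd y & (d %| y)%N] ->
    [/\ p = 5 %[mod 8], kronecker p%:Z q%:Z = -1 & (d %| y)%N].
  case=> p_mod8 y_odd d_y; split=> //; rewrite kronE ifF //.
  case: fintype.existsP => // -[u q_u]; exfalso.
  have [a [b Dab]] : form_repr2 p q.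
    subst d; have [B|//] := y_odd_repr2 p_prime q_prime p_mod4 q_mod4 unitsE epsE y_odd.
    by case: (noB5 p_mod8 B).
  have [t Dt] := dvdzP q_u.
  have Dua : ((u : nat)%:Z * a) ^+ 2 = p%:Z * a ^+ 2 + q%:Z * (t * a ^+ 2).
    by rewrite exprMn -[_ ^+ 2 in LHS](subrK p%:Z) Dt; ring.
  (* With p = 5 mod 8 the residue of q mod 8 decides the sign of the value 2 or -2, and in each case
     that value is a nonresidue mod q. *)
  have [q8|q8] : (q %% 8 = 3 \/ q %% 8 = 7)%N by move: q_mod4; clear; lia.
    have D2 : p%:Z * a ^+ 2 - q%:Z * b ^+ 2 = 2.
      case: (sqrz_mod8 a) => [[k [j [_ Ea]]]|[k [_ Ea]]];
      case: (sqrz_mod8 b) => [[k' [j' [_ Eb]]]|[k' [_ Eb]]];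
      move: Dab; rewrite Ea Eb (divn_eq p 8) (divn_eq q 8) p_mod8 q8; clear; lia.
    have /negP[] := @nonresidue2 q q_prime ((u : nat)%:Z * a) (or_introl q8).
    by apply/dvdzP; exists (b ^+ 2 + t * a ^+ 2); rewrite Dua -D2; ring.
  have D2 : p%:Z * a ^+ 2 - q%:Z * b ^+ 2 = -2.
    case: (sqrz_mod8 a) => [[k [j [_ Ea]]]|[k [_ Ea]]];
    case: (sqrz_mod8 b) => [[k' [j' [_ Eb]]]|[k' [_ Eb]]];
    move: Dab; rewrite Ea Eb (divn_eq p 8) (divn_eq q 8) p_mod8 q8; clear; lia.
  have /negP[] := @nonresidueN2 q q_prime ((u : nat)%:Z * a) (or_intror q8).
  by apply/dvdzP; exists (b ^+ 2 + t * a ^+ 2); rewrite Dua -[2]opprK -D2; ring.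
have step32 : [/\ p = 5 %[mod 8], kronecker p%:Z q%:Z = -1 & (d %| y)%N] ->
    [/\ p = 5 %[mod 8], odd y & (d %| y)%N].
  case=> p_mod8 kron d_y; split=> //; apply: contraT => y_even.
  have [a [b Dab]] : form_repr1 p q.
    subst d; exact: (y_even_form_repr1 p_prime q_prime p_mod4 q_mod4
      eps_gt1 unitsE epsE y_even).
  have D1 : p%:Z * a ^+ 2 - q%:Z * b ^+ 2 = 1.
    case: (sqrz_mod8 a) => [[k [j [_ Ea]]]|[k [_ Ea]]];
    case: (sqrz_mod8 b) => [[k' [j' [_ Eb]]]|[k' [_ Eb]]];
    move: Dab; rewrite Ea Eb (divn_eq p 4) (divn_eq q 4) p_mod4 q_mod4; clear; lia.
  have : coprimez a q.
    apply/coprimezP; exists (p%:Z * a, - b ^+ 2) => /=; rewrite -[RHS]D1; ring.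
  move=> /coprimezP[[u v] /= uv].
  (* As p a^2 = 1 mod q, the inverse u of a is a square root of p; the Kronecker symbol asks for its
     reduced residue. *)
  have [r [Dr r_lt]] : exists r : nat, (exists m, u = r%:Z + m * q%:Z) /\ (r < q)%N.
    have nz_q : q%:Z != 0 by rewrite eqz_nat -lt0n.
    have r_ge0 := modz_ge0 u nz_q.
    exists `|(u %% q)%Z|%N; split.
      by exists (u %/ q)%Z; rewrite gez0_abs // addrC; apply: divz_eq.
    by rewrite -ltz_nat gez0_abs // ltz_pmod // ltz_nat.
  have [m Dm] := Dr; move: kron; rewrite kronE ifT //.
  apply/fintype.existsP; exists (Ordinal r_lt) => /=; apply/dvdzP.
  have -> : r%:Z = u - m * q%:Z by rewrite Dm addrK.
  have Dua : u * a = 1 - v * q%:Z by rewrite -uv addrK.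
  exists (u ^+ 2 * - b ^+ 2 - 2 * u * m + m ^+ 2 * q%:Z + p%:Z * v * (v * q%:Z - 2)).
  have Du2 : u ^+ 2 = p%:Z * (u * a) ^+ 2 - u ^+ 2 * (q%:Z * b ^+ 2).
    transitivity (u ^+ 2 * (p%:Z * a ^+ 2 - q%:Z * b ^+ 2)); first by rewrite D1 mulr1.
    by ring.
  transitivity (u ^+ 2 - 2 * u * m * q%:Z + m ^+ 2 * q%:Z ^+ 2 - p%:Z); first by ring.
  by rewrite {1}Du2 Dua; ring.
have step21 : [/\ p = 5 %[mod 8], odd y & (d %| y)%N] ->
    unusual_conductors d = [set 2%N].
  case=> p_mod8 y_odd d_y; have noB := noB5 p_mod8.
  have C : form_repr2 p q.
    by subst d; have [] := y_odd_repr2 p_prime q_prime p_mod4 q_mod4 unitsE epsE y_odd.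
  have noA : ~ form_repr1 p q by move=> A; apply/noB/form_repr_mul.
  apply/seteqP; split=> [f | _ ->]; last first.
    apply: two_unusual => //.
    by subst d; apply: (card_Pic_two p_prime q_prime p_mod4 q_mod4 unitsE epsE).
  case=> [[f_gt0 sq_f] [r [[r_prime _] r_f]] _ [_ hf] _]; rewrite orderE in hf.
  have no_odd_ramified l : prime l -> odd l -> (l %| d)%N -> ~~ (l %| f)%N.
    move=> l_prime l_odd l_d; apply/negP => l_f.
    have [g [Df l_g g_gt0]] := squarefree_factor sq_f l_prime l_f f_gt0.
    have l_y := dvdn_trans l_d d_y; rewrite Df in hf; subst d.
    exact: (card_Pic_ramified_neq2 p_mod4 q_mod4 eps_gt1 unitsE epsE
      l_prime l_odd l_d l_y l_g g_gt0 hf).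
  have p_f : ~~ (p %| f)%N by apply: no_odd_ramified; rewrite // d_def dvdn_mulr.
  have no_odd l : prime l -> (l %| f)%N -> l = 2%N.
    move=> l_prime l_f; case: (even_prime l_prime) => // l_odd.
    have [l_d|l_d] := boolP (l %| d)%N.
      by move: l_f; rewrite (negPf (no_odd_ramified l l_prime l_odd l_d)).
    have [g [Df l_g g_gt0]] := squarefree_factor sq_f l_prime l_f f_gt0.
    rewrite Df in hf p_f; subst d.
    by case: (card_Pic_unramified_neq2 p_prime q_prime p_mod4 q_mod4 eps_gt1 unitsE epsE
      l_prime l_odd l_d l_g g_gt0 p_f noA).
  have two_f : (2 %| f)%N by rewrite -(no_odd r).
  have [g [Df g_odd g_gt0]] := squarefree_factor sq_f (isT : prime 2) two_f f_gt0.
  have [g1|g_gt1] : g = 1%N \/ (1 < g)%N by move: g_gt0; clear; lia.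
    by rewrite /= Df g1.
  have := no_odd _ (pdiv_prime g_gt1); rewrite Df dvdn_mull ?pdiv_dvd // => /(_ isT) g2.
  by move: g_odd; rewrite -g2 pdiv_dvd.
(* The cycle closes from (3) to (1) through (2). *)
tfae => // /step32; exact: step21.
Qed.
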